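(* Let $L$ be an oriented link in $S^3$ with exactly $n$ components. If $n$ is odd, then the minimum of $\#\tau(D)$, where $D$ ranges over all diagrams of $L$, equals $1$. If $n$ is even, this minimum equals $2$.
   Context: A diagram of an oriented link is an oriented link projection together with over/under information at each crossing point. An oriented link projection is the image of a generic immersion (only transverse double points, called crossing points) of finitely many oriented circles into $S^2$. For a diagram $D$, forget the over/under information to obtain a projection. Then apply at every crossing point the orientation-incoherent smoothing, i.e. the smoothing that joins the two incoming half-edges to each other and the two outgoing half-edges to each other. Finally forget orientations. The result is a disjoint union of simple closed curves in $S^2$, called the circle arrangement $\tau(D)$. The number of circles in it is denoted $\#\tau(D)$. *)

(* Defs.v *)
(* Combinatorial model of oriented
   link diagrams on S^2 (signed Gauss diagrams that are planar), the circle
   arrangement tau(D), and link equivalence via Reidemeister moves. *)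
From HB Require Import structures.
From mathcomp Require Import all_boot all_fingroup.
Set Implicit Arguments.
Unset Strict Implicit.
Unset Printing Implicit Defensive.

(* Points of a diagram: (x, true) = the passage of the over-strand through the
   crossing x, (x, false) = the passage of the under-strand through x;
   inr m = a marker (an auxiliary point of valence 2 on the curve, used to
   represent crossingless components and to subdivide edges). *)
Notation pt X M := ((X * bool)%type + M)%type.

(* Half-edges ("darts"): (p, true) = incoming half-edge at p,
   (p, false) = outgoing half-edge at p. *)
Notation dart X M := (pt X M * bool)%type.

Section Combinatorics.
Variables (X M : finType).

(* The edge involution: the outgoing half-edge at p is glued to the incoming
   half-edge at the next point succ p along the oriented link. *)
Definition edge (s : {perm pt X M}) (d : dart X M) : dart X M :=
  if d.2 then ((s^-1)%g d.1, false) else (s d.1, true).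

(* Counterclockwise rotation of the half-edges around a vertex.  Around a
   crossing x the cyclic (counterclockwise) order is
     0: under-in, 1: over-in if sg x else over-out, 2: under-out,
     3: over-out if sg x else over-in.
   Around a marker the two half-edges are swapped. *)
Definition rot (sg : X -> bool) (d : dart X M) : dart X M :=
  match d.1 with
  | inl (x, ov) =>
      if ov then (inl (x, false), d.2 != sg x) else (inl (x, true), d.2 == sg x)
  | inr m => (inr m, ~~ d.2)
  end.

(* Orientation-incoherent smoothing: at a crossing the two incoming half-edges
   are joined, and the two outgoing half-edges are joined; at a marker the
   curve simply passes through. *)
Definition smooth (d : dart X M) : dart X M :=
  match d.1 with
  | inl (x, ov) => (inl (x, ~~ ov), d.2)
  | inr m => (inr m, ~~ d.2)
  end.
End Combinatorics.

Definition ncomp (T : finType) (r : rel T) : nat :=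
  n_comp [rel x y | r x y || r y x] predT.

Definition rel_of2 (T : finType) (f g : T -> T) : rel T :=
  [rel x y | (y == f x) || (y == g x)].

(* Planarity (genus 0 of every component of the underlying 4-valent map):
   #faces = #crossings + 2 * #(connected components). *)
Definition planarb (X M : finType) (s : {perm pt X M}) (sg : X -> bool) : bool :=
  ncomp [rel d e | e == rot sg (edge s d)]
    == #|X| + 2 * ncomp (rel_of2 (rot sg) (edge s)).

Record diagram : Type := Diagram {
  crs : finType;
  mrk : finType;
  succ : {perm pt crs mrk};
  sgn : crs -> bool;
  diagram_planar : planarb succ sgn
}.
Arguments succ : clear implicits.
Arguments sgn : clear implicits.

Definition ncomponents (D : diagram) : nat :=
  ncomp [rel p q | q == succ D p].

(* #tau(D): number of circles of the orientation-incoherent smoothing. *)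
Definition ntau (D : diagram) : nat :=
  ncomp (rel_of2 (@smooth (crs D) (mrk D)) (edge (succ D))).

Definition liftp (X X' M M' : finType) (f : X -> X') (g : M -> M')
  (p : pt X M) : pt X' M' :=
  match p with inl (x, b) => inl (f x, b) | inr m => inr (g m) end.

Definition swap2 (T : eqType) (a b : T) (r : T) : T :=
  if r == a then b else if r == b then a else r.

Definition move_iso (D D' : diagram) : Prop :=
  exists (f : crs D -> crs D') (g : mrk D -> mrk D'),
    [/\ bijective f, bijective g, (forall x, sgn D' (f x) = sgn D x) &
        forall q, succ D' (liftp f g q) = liftp f g (succ D q)].

Definition move_marker (D D' : diagram) : Prop :=
  exists (f : crs D -> crs D') (g : mrk D -> mrk D') (m0 : mrk D') (p : pt (crs D) (mrk D)),
    [/\ bijective f, injective g, (forall m, g m != m0),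
        (forall m', m' = m0 \/ exists m, m' = g m) &
        (forall x, sgn D' (f x) = sgn D x)] /\
    [/\ (forall q, q != p -> succ D' (liftp f g q) = liftp f g (succ D q)),
        succ D' (liftp f g p) = inr m0 &
        succ D' (inr m0) = liftp f g (succ D p)].

(* Reidemeister I (all four variants): a kink with new crossing c inserted on
   the edge leaving p; a says which passage (over/under) comes first. *)
Definition move_R1 (D D' : diagram) : Prop :=
  exists (f : crs D -> crs D') (g : mrk D -> mrk D') (c : crs D')
         (p : pt (crs D) (mrk D)) (a : bool),
    [/\ injective f, (forall x, f x != c),
        (forall x', x' = c \/ exists x, x' = f x), bijective g &
        (forall x, sgn D' (f x) = sgn D x)] /\
    [/\ (forall q, q != p -> succ D' (liftp f g q) = liftp f g (succ D q)),
        succ D' (liftp f g p) = inl (c, a),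
        succ D' (inl (c, a)) = inl (c, ~~ a) &
        succ D' (inl (c, ~~ a)) = liftp f g (succ D p)].

(* Reidemeister II (all variants): the strand through the edge leaving p
   passes (over if t, under otherwise) through two new crossings c1, c2,
   the strand through the edge leaving q passes the other way through them,
   in either order; the two new crossings have opposite types. *)
Definition move_R2 (D D' : diagram) : Prop :=
  exists (f : crs D -> crs D') (g : mrk D -> mrk D') (c1 c2 : crs D')
         (p q : pt (crs D) (mrk D)) (t o : bool),
    let d1 := if o then c1 else c2 in
    let d2 := if o then c2 else c1 in
    [/\ injective f, c1 != c2, (forall x, f x != c1 /\ f x != c2),
        (forall x', [\/ x' = c1, x' = c2 | exists x, x' = f x]) &
        bijective g] /\
    [/\ (forall x, sgn D' (f x) = sgn D x),
        sgn D' c2 = ~~ sgn D' c1 & p != q] /\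
      [/\ (forall r, r != p -> r != q ->
             succ D' (liftp f g r) = liftp f g (succ D r)),
          succ D' (liftp f g p) = inl (c1, t),
          succ D' (inl (c1, t)) = inl (c2, t) &
          succ D' (inl (c2, t)) = liftp f g (succ D p)] /\
      [/\ succ D' (liftp f g q) = inl (d1, ~~ t),
          succ D' (inl (d1, ~~ t)) = inl (d2, ~~ t) &
          succ D' (inl (d2, ~~ t)) = liftp f g (succ D q)].

(* Reidemeister III (all variants): three crossings x = T/M, y = T/B,
   z = M/B (top strand T over M and B, M over B) whose six passages form
   three consecutive pairs along the link; the move reverses the order inside
   each pair.  oT : x before y on T; oM : x before z on M; oB : y before z on B.
   The sign condition characterizes the configurations that occur for three
   strands around a triangle. *)
Definition move_R3 (D D' : diagram) : Prop :=
  exists (f : crs D -> crs D') (g : mrk D -> mrk D') (x y z : crs D)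
         (oT oM oB : bool),
    let s := succ D in
    let xo := inl (x, true) in let xu := inl (x, false) in
    let yo := inl (y, true) in let yu := inl (y, false) in
    let zo := inl (z, true) in let zu := inl (z, false) in
    let sw (r : pt (crs D) (mrk D)) :=
      swap2 xo yo (swap2 xu zo (swap2 yu zu r)) in
    [/\ bijective f, bijective g, (forall x, sgn D' (f x) = sgn D x) &
        [&& x != y, y != z & x != z]] /\
    [/\ (if oT then s xo == yo else s yo == xo),
        (if oM then s xu == zo else s zo == xu),
        (if oB then s yu == zu else s zu == yu),
        (sgn D x (+) sgn D y = oM (+) oB) /\ (sgn D y (+) sgn D z = oT (+) oM) &
        forall r, succ D' (liftp f g r) = liftp f g (sw (s (sw r)))].

Definition reid_step (D D' : diagram) : Prop :=
  [\/ move_iso D D', move_marker D D', move_R1 D D' | move_R2 D D' \/ move_R3 D D'].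

(* Equivalence of diagrams (= same oriented link in S^3): equivalence relation
   generated by the moves above. *)
Inductive link_equiv : diagram -> diagram -> Prop :=
  | le_refl D : link_equiv D D
  | le_step D D' : reid_step D D' -> link_equiv D D'
  | le_sym D D' : link_equiv D D' -> link_equiv D' D
  | le_trans D1 D2 D3 : link_equiv D1 D2 -> link_equiv D2 D3 -> link_equiv D1 D3.

Definition min_tau_is (D0 : diagram) (k : nat) : Prop :=
  (exists D, link_equiv D0 D /\ ntau D = k) /\
  (forall D, link_equiv D0 D -> k <= ntau D).

(* Main.v *)
(* Lower bound: the number of circles of tau(D) has the parity of n for every
   diagram D.  As D is planar, its faces have a checkerboard colouring, so the
   half-edges can be 2-coloured alternately around each vertex and along each
   edge.  On the half-edges of one colour both the Seifert smoothing and the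
   incoherent smoothing become permutations, which differ by one transposition
   per crossing; the Seifert circles also differ from the link components by
   one transposition per crossing.

   Upper bound: as long as there are three circles, their number can be lowered.
   A Reidemeister II move between parallel strands of two different circles
   merges these circles and creates a small one, so it does not increase the
   number.  Such moves make D connected; then some crossing x touches two
   different circles, and further such moves (with kinks to adjust the
   directions) bring a third circle to a face at x.  There a Reidemeister III
   move merges the three circles. *)
Require Import Defs.
From mathcomp Require Import all_boot all_fingroup.
From mathcomp Require Import all_algebra zify.
Import fingraph Defs.
Set Implicit Arguments.
Unset Strict Implicit.
Unset Printing Implicit Defensive.

(** Genus 0 is available only as an equation between the numbers of faces, crossings and components,
    and each move needs a proof of this equation for the new diagram. Faces never outnumber the
    planar value (Euler's inequality), so it suffices to find enough faces, that is, a function that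
    is constant on faces and takes enough values. Circles, in contrast, are bounded from above, by
    mapping old half-edges to new ones.

    A parallel Reidemeister II move between different circles pays for each merge with a small
    circle, so such moves alone do not lower the number. The Reidemeister III move gets round this:
    after it, the smoothed tangle contains no closed loop. The small circle is nevertheless what
    brings a third circle to [x]: a finger pushed across an edge leaves it on the far side of that
    edge, nearer to [x]. The length of a walk over the sphere from [x] to a third circle therefore
    drops, and it serves as the induction measure. *)

(** * Counting the classes of a relation *)

Definition sym_rel (T : finType) (r : rel T) : rel T :=
  fun x y => r x y || r y x.
Notation con r := (connect (sym_rel r)).

Section Components.
Variables (T : finType) (r : rel T).

Lemma con_sym : connect_sym (sym_rel r).
Proof. by apply: sym_connect_sym => x y; rewrite /sym_rel orbC. Qed.

Lemma con1 x y : r x y -> con r x y.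
Proof. by move=> rxy; apply: connect1; rewrite /sym_rel rxy. Qed.

Lemma con1r x y : r y x -> con r x y.
Proof. by move=> rxy; rewrite con_sym con1. Qed.

Lemma con_const (K : Type) (f : T -> K) x y :
  (forall x y, r x y -> f x = f y) -> con r x y -> f x = f y.
Proof.
move=> fr /connectP[p]; elim: p x => [|z p IH] x /=; first by move=> _ ->.
by case/andP=> /orP[/fr->|/fr<-] /IH.
Qed.

Lemma con_map (T' : finType) (r' : rel T') (h : T -> T') x y :
  (forall x y, r x y -> con r' (h x) (h y)) -> con r x y -> con r' (h x) (h y).
Proof.
move=> hr /connectP[p]; elim: p x => [|z p IH] x /=.
  by move=> _ ->; apply: connect0.
case/andP=> rxz pzp defy; apply: connect_trans (IH _ pzp defy).
case/orP: rxz => /hr //; rewrite sym_connect_sym // => u v.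
by rewrite /sym_rel orbC.
Qed.

Lemma ncompE : ncomp r = #|roots (sym_rel r)|.
Proof. by apply: eq_card => x; rewrite !inE andbT. Qed.

Lemma ncomp_le_cover (B : {set T}) :
  (forall y, exists2 b, b \in B & con r y b) -> ncomp r <= #|B|.
Proof.
move=> cov; rewrite ncompE.
apply: leq_trans (leq_imset_card (root (sym_rel r)) B).
apply: subset_leq_card; apply/subsetP=> y; rewrite -topredE /= /roots => /eqP ry.
have [b bB yb] := cov y; apply/imsetP; exists b => //.
by rewrite -ry; apply/eqP; rewrite root_connect //; exact: con_sym.
Qed.

Lemma ncomp_ge_const (K : finType) (f : T -> K) (A : {set K}) :
  (forall x y, r x y -> f x = f y) -> (forall a, a \in A -> exists x, f x = a) ->
  #|A| <= ncomp r.
Proof.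
move=> fr fA; rewrite ncompE; apply: leq_trans (leq_imset_card f (roots (sym_rel r))).
apply: subset_leq_card; apply/subsetP=> a /fA[x <-]; apply/imsetP.
exists (root (sym_rel r) x); first by rewrite -topredE /= roots_root //; apply: con_sym.
by apply: con_const => //; apply: connect_root.
Qed.

Lemma ncomp_gt0 : T -> 0 < ncomp r.
Proof.
move=> x; rewrite ncompE; apply/card_gt0P; exists (root (sym_rel r) x).
by rewrite -topredE /= roots_root //; apply: con_sym.
Qed.

End Components.

Lemma exists_ncon (T : finType) (r : rel T) (B : {set T}) :
  #|B| < ncomp r -> exists x, forall b, b \in B -> ~~ con r x b.
Proof.
move=> Br; have [/existsP[x /forall_inP xB]|] :=
  boolP [exists x, [forall (b | b \in B), ~~ con r x b]]; first by exists x.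
rewrite negb_exists => /forallP cov; move: Br; rewrite ltnNge => /negP[].
apply: ncomp_le_cover => y; have := cov y; rewrite negb_forall_in.
by case/exists_inP=> b bB; rewrite negbK; exists b.
Qed.

(** [A] accounts for the classes that [h] misses, such as the small circle created by a Reidemeister
    II move. *)
Lemma ncomp_le_map (T T' : finType) (r : rel T) (r' : rel T') (h : T -> T')
    (A : {set T'}) :
  (forall x y, r x y -> con r' (h x) (h y)) ->
  (forall y, (exists x, con r' y (h x)) \/ exists2 a, a \in A & con r' y a) ->
  ncomp r' <= ncomp r + #|A|.
Proof.
move=> hr cov.
apply: leq_trans (_ : #|(h @: [set x in roots (sym_rel r)]) :|: A| <= _).
  apply: ncomp_le_cover => y; case: (cov y) => [[x yx]|[a aA ya]]; last first.
    by exists a; rewrite // inE aA orbT.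
  exists (h (root (sym_rel r) x)).
    rewrite inE; apply/orP; left; apply: imset_f; rewrite inE -topredE /=.
    by rewrite roots_root //; apply: con_sym.
  by apply: connect_trans yx _; apply: con_map hr _; apply: connect_root.
apply: leq_trans (leq_card_setU _ _) _; rewrite leq_add2r ncompE.
by apply: leq_trans (leq_imset_card _ _) _; rewrite cardsE.
Qed.

Lemma ncomp_lt_map (T T' : finType) (r : rel T) (r' : rel T') (h : T -> T')
    (A : {set T'}) (a b : T) :
  (forall x y, r x y -> con r' (h x) (h y)) ->
  (forall y, (exists x, con r' y (h x)) \/ exists2 a, a \in A & con r' y a) ->
  ~~ con r a b -> con r' (h a) (h b) ->
  ncomp r' < ncomp r + #|A|.
Proof.
move=> hr cov nab ab.
set R := [set x in roots (sym_rel r)].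
have rR x : root (sym_rel r) x \in R.
  by rewrite inE -topredE /= roots_root //; apply: con_sym.
have conhr x : con r' (h x) (h (root (sym_rel r) x)).
  by apply: con_map hr _; apply: connect_root.
have cR : #|R| = ncomp r by rewrite ncompE cardsE.
set rb := root (sym_rel r) b.
apply: leq_ltn_trans (_ : #|(h @: (R :\ rb)) :|: A| < _).
  apply: ncomp_le_cover => y; case: (cov y) => [[x yx]|[c cA yc]]; last first.
    by exists c; rewrite // inE cA orbT.
  case: (eqVneq (root (sym_rel r) x) rb) => [xb|xb]; last first.
    exists (h (root (sym_rel r) x)); last by apply: connect_trans yx _.
    by rewrite inE imset_f // in_setD1 xb rR.
  exists (h (root (sym_rel r) a)).
    rewrite inE imset_f // in_setD1 rR andbT.
    by rewrite root_connect //; apply: con_sym.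
  apply: connect_trans yx _; apply: connect_trans (conhr x) _; rewrite xb.
  have := conhr a; rewrite con_sym => ha; rewrite con_sym; apply: connect_trans ha _.
  by apply: connect_trans ab _; apply: conhr.
apply: leq_ltn_trans (leq_card_setU _ _) _; rewrite ltn_add2r.
apply: leq_ltn_trans (leq_imset_card _ _) _.
by rewrite -cR (cardsD1 rb R) rR.
Qed.


Lemma ncomp_eq_map (T T' : finType) (r : rel T) (r' : rel T') (h : T -> T') (k : T' -> T) :
  (forall x y, r x y -> con r' (h x) (h y)) -> (forall y, con r' y (h (k y))) ->
  (forall x y, r' x y -> con r (k x) (k y)) -> (forall x, con r x (k (h x))) ->
  ncomp r = ncomp r'.
Proof.
move=> hr hk kr kh; apply/eqP; rewrite eqn_leq; apply/andP; split.
  have := @ncomp_le_map _ _ r' r k set0 kr; rewrite cards0 addn0; apply=> x.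
  by left; exists (h x).
have := @ncomp_le_map _ _ r r' h set0 hr; rewrite cards0 addn0; apply=> y.
by left; exists (k y).
Qed.

Definition next_rel (T : finType) (f : T -> T) : rel T := fun x y => y == f x.

Lemma con_next_porbit (T : finType) (s : {perm T}) x y :
  con (next_rel s) x y = (y \in porbit s x).
Proof.
apply/idP/idP => [xy|/porbitP[i ->]].
  rewrite -eq_porbit_mem eq_sym; apply/eqP; apply: con_const xy => u v /eqP->.
  by rewrite -(porbit_perm s 1 u) expg1.
elim: i => [|i IH]; first by rewrite perm1 connect0.
by apply: connect_trans IH _; apply: con1; rewrite /next_rel expgSr permM.
Qed.

Lemma ncomp_perm (T : finType) (s : {perm T}) :
  ncomp (next_rel s) = #|porbits s|.
Proof.
apply/eqP; rewrite eqn_leq; apply/andP; split.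
  rewrite ncompE; rewrite -(card_in_imset (f := porbit s) (D := mem (roots (sym_rel (next_rel s))))).
    by apply: subset_leq_card; apply/subsetP=> _ /imsetP[x _ ->]; apply: imset_f.
  move=> x y; rewrite -!topredE /= /roots => /eqP rx /eqP ry /eqP.
  rewrite eq_porbit_mem -con_next_porbit => yx; rewrite -rx -ry.
  by apply/eqP; rewrite root_connect 1?(con_sym _ x); [exact: yx|exact: con_sym].
apply: (ncomp_ge_const (f := porbit s)) => [x y /eqP->|a /imsetP[x _ ->]]; last by exists x.
by rewrite -(porbit_perm s 1 x) expg1.
Qed.

(** * Half-edges, vertices and faces of a diagram *)

Section Maps.
Variables (X M : finType) (s : {perm pt X M}) (sg : X -> bool).
Implicit Types d : dart X M.

Lemma edgeK : involutive (edge s).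
Proof. by case=> w [] ; rewrite /edge /= ?permK ?permKV. Qed.

Lemma edge_flip d : (edge s d).2 = ~~ d.2.
Proof. by case: d => w []. Qed.

Lemma smoothK : involutive (@smooth X M).
Proof. by case=> [[[x ov]|m] b]; rewrite /smooth /= ?negbK. Qed.

Lemma rot_dart_inj : injective (@rot X M sg).
Proof.
apply: (can_inj (g := rot (fun x => ~~ sg x) : dart X M -> dart X M)).
by case=> [[[x []]|m] b]; rewrite /rot /= ?negbK //; case: b; case: (sg x).
Qed.

(* Its cycles are the faces: the cycle of [(p, false)] is the face to the right
   of the edge leaving [p], that of [(s p, true)] the face to its left. *)
Definition face_step d := rot sg (edge s d).

Lemma face_step_inj : injective face_step.
Proof. by move=> d e /rot_dart_inj /(inv_inj edgeK). Qed.

Definition vertex (w : pt X M) : X + M :=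
  match w with inl (x, _) => inl x | inr m => inr m end.

Lemma vertex_rot d : vertex (rot sg d).1 = vertex d.1.
Proof. by case: d => [[[x []]|m] b]. Qed.

Definition crel : rel (dart X M) := rel_of2 (rot sg) (edge s).

Lemma planarbE :
  planarb s sg = (ncomp (next_rel face_step) == #|X| + 2 * ncomp crel).
Proof. by []. Qed.

Lemma crel_const (K : Type) (g : dart X M -> K) d e :
  (forall d, g (rot sg d) = g d) -> (forall d, g (edge s d) = g d) ->
  con crel d e -> g d = g e.
Proof. by move=> gr ge; apply: con_const => u v /orP[]/eqP->. Qed.

Lemma con_rot d : con crel d (rot sg d).
Proof. by apply: con1; rewrite /crel /rel_of2 /= eqxx. Qed.

Lemma con_edge d : con crel d (edge s d).
Proof. by apply: con1; rewrite /crel /rel_of2 /= eqxx orbT. Qed.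

Lemma con_vertex d e : vertex d.1 = vertex e.1 -> con crel d e.
Proof.
have C1 := con_rot; have C2 f := connect_trans (C1 f) (C1 _).
have C3 f := connect_trans (C2 f) (C1 _).
case: d e => [[[x ov]|m] b] [[[y ov']|m'] b'] //= [->]; last first.
  by case: (eqVneq b b') => [->|nb]; [exact: connect0|move: (C1 (inr m', b)); case: b b' nb => [] []].
move: (C1 (inl (y, ov), b)) (C2 (inl (y, ov), b)) (C3 (inl (y, ov), b)).
rewrite /rot; case: ov ov' b b' => [] [] [] []; rewrite /= ; case: (sg y) => /= H1 H2 H3;
  solve [exact: connect0 | exact: H1 | exact: H2 | exact: H3].
Qed.

End Maps.

(** * Euler's inequality over F_2 *)

Section LinearAlgebra.
Import GRing.Theory.
Local Open Scope ring_scope.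

Lemma F2_addxx (x : 'F_2) : x + x = 0.
Proof. by rewrite addrr_pchar2 // pchar_Fp. Qed.

Lemma F2_add0 (x y : 'F_2) : x + y = 0 -> x = y.
Proof. by move=> xy; rewrite -[x]addr0 -(F2_addxx y) addrA xy add0r. Qed.

(** The left kernel of [A] embeds into the coordinates in [R], so its dimension [m - \rank A] is at
    most [#|R|]. *)
Lemma rank_ge_rows (F : fieldType) (m n : nat) (A : 'M[F]_(m, n)) (R : {set 'I_m}) :
  (forall u : 'rV[F]_m, u *m A = 0 -> (forall i, i \in R -> u 0 i = 0) -> u = 0) ->
  (m <= \rank A + #|R|)%N.
Proof.
move=> inj; pose P : 'M[F]_(m, #|R|) := colsub (@enum_val _ (mem R)) 1%:M.
have PE (u : 'rV[F]_m) : u *m P = colsub (@enum_val _ (mem R)) u.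
  by rewrite /P mulmx_colsub mulmx1.
have K0 : (kermx A :&: kermx P)%MS = 0.
  apply/eqP/rowV0P => v; rewrite sub_capmx => /andP[/sub_kermxP vA /sub_kermxP vP].
  apply: inj => // i iR; move/matrixP: vP => /(_ 0 (enum_rank_in iR i)).
  by rewrite PE !mxE enum_rankK_in.
have := mxrank_mul_ker (kermx A) P; rewrite K0 mxrank0 addn0 mxrank_ker => rk.
by rewrite -leq_subLR -rk rank_leq_col.
Qed.

Lemma sum_delta (T : finType) (g : 'I_#|T| -> 'F_2) (x : T) :
  \sum_i g i * (enum_val i == x)%:R = g (enum_rank x).
Proof.
rewrite (bigD1 (enum_rank x)) //= enum_rankK eqxx mulr1 big1 ?addr0 // => i ix.
by rewrite -(inj_eq enum_rank_inj) enum_valK (negPf ix) mulr0.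
Qed.

Section Euler.
Variables (X M : finType) (s : {perm pt X M}) (sg : X -> bool).
Local Notation phi := (face_step s sg).
Local Notation T := (dart X M).

Definition face_root (d : T) := root (sym_rel (next_rel phi)) d.
Local Notation fr := face_root.

Lemma face_root_phi d : fr (phi d) = fr d.
Proof.
apply/eqP; rewrite root_connect; last exact: con_sym.
by apply: con1r; rewrite /next_rel.
Qed.

(** With [edge_vertex_mx], the cellular boundary maps mod 2. A face is represented by its root; the
    rows of all other half-edges vanish. *)
Definition face_edge_mx : 'M['F_2]_(#|{: T}|, #|{: pt X M}|) :=
  \matrix_(i, j) ((enum_val i == fr (enum_val j, false))%:R
                  + (enum_val i == fr (s (enum_val j), true))%:R).
Definition edge_vertex_mx : 'M['F_2]_(#|{: pt X M}|, #|{: X + M}|) :=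
  \matrix_(j, k) ((enum_val k == vertex (enum_val j))%:R
                  + (enum_val k == vertex (s (enum_val j)))%:R).
Local Notation A := face_edge_mx.
Local Notation B := edge_vertex_mx.

Lemma mul_face_edge (u : 'rV_#|{: T}|) (p : pt X M) :
  (u *m A) 0 (enum_rank p)
    = u 0 (enum_rank (fr (p, false))) + u 0 (enum_rank (fr (s p, true))).
Proof.
rewrite mxE; under eq_bigr do rewrite mxE mulrDr enum_rankK.
by rewrite big_split /= !sum_delta.
Qed.

Lemma mul_edge_vertex (w : 'rV_#|{: X + M}|) (p : pt X M) :
  (w *m B^T) 0 (enum_rank p)
    = w 0 (enum_rank (vertex p)) + w 0 (enum_rank (vertex (s p))).
Proof.
rewrite mxE; under eq_bigr do rewrite 2!mxE mulrDr enum_rankK.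
by rewrite big_split /= !sum_delta.
Qed.

(** A sum of faces with zero boundary has equal coefficients on the two sides of each edge, so one
    coefficient per component determines it. The zero rows of the half-edges that are not roots
    cancel in the count. *)
Lemma rank_face_edge :
  (ncomp (next_rel phi) <= \rank A + ncomp (crel s sg))%N.
Proof.
pose rt d := root (sym_rel (crel s sg)) d.
pose R := [set enum_rank d | d in [set d | fr d != d]]
  :|: [set enum_rank (fr d) | d in [set d | rt d == d]].
have H : (#|{: T}| <= \rank A + #|R|)%N.
  apply: rank_ge_rows => u uA uR; apply/rowP => i; rewrite mxE.
  pose g d := u 0 (enum_rank (fr d)).
  have gphi d : g (phi d) = g d by rewrite /g face_root_phi.
  have gedge d : g (edge s d) = g d.
    have E p : g (s p, true) = g (p, false).
      apply/esym/F2_add0; rewrite /g -mul_face_edge uA mxE //.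
    by case: d => p [] /=; rewrite /edge /= ?E // -E permKV.
  have grot d : g (rot sg d) = g d.
    by have := gphi (edge s d); rewrite /face_step edgeK gedge.
  have g0 d : g d = 0.
    rewrite (@crel_const _ _ s sg _ g d (rt d)) //; last exact: connect_root.
    apply: uR; rewrite inE; apply/orP; right; apply: imset_f.
    by rewrite inE /rt root_root //; apply: con_sym.
  rewrite -[i]enum_valK; set d := enum_val i.
  case: (eqVneq (fr d) d) => [<-|nd]; first exact: g0.
  by apply: uR; rewrite inE imset_f // inE.
have cR : (#|R| <= #|[set d | fr d != d]| + ncomp (crel s sg))%N.
  apply: leq_trans (leq_card_setU _ _) _; apply: leq_add; first exact: leq_imset_card.
  apply: leq_trans (leq_imset_card _ _) _; rewrite ncompE cardsE.
  by apply: subset_leq_card; apply/subsetP.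
have cN : (#|{: T}| = #|[set d | fr d != d]| + ncomp (next_rel phi))%N.
  rewrite ncompE -(cardsC [set d | fr d != d]); congr (_ + _)%N.
  rewrite -[RHS]cardsE; apply: eq_card => d; rewrite !inE negbK.
  by [].
rewrite -(leq_add2l #|[set d | fr d != d]|) -cN addnCA.
by apply: leq_trans H _; rewrite leq_add2l.
Qed.

(** Dually, a function on vertices with zero coboundary is constant on each component. *)
Lemma rank_edge_vertex : (#|X| + #|M| <= \rank B + ncomp (crel s sg))%N.
Proof.
pose rt d := root (sym_rel (crel s sg)) d.
pose R := [set enum_rank (vertex d.1) | d in [set d | rt d == d]].
have H : (#|{: X + M}| <= \rank B^T + #|R|)%N.
  apply: rank_ge_rows => w wB wR; apply/rowP => k; rewrite mxE.
  pose g (d : T) := w 0 (enum_rank (vertex d.1)).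
  have gedge d : g (edge s d) = g d.
    have E p b b': g (s p, b) = g (p, b').
      apply/esym/F2_add0; rewrite /g -mul_edge_vertex wB mxE //.
    by case: d => p []; [rewrite -{2}[p](permKV s); apply/esym/E | apply: E].
  have grot d : g (rot sg d) = g d by rewrite /g vertex_rot.
  have g0 d : g d = 0.
    rewrite (@crel_const _ _ s sg _ g d (rt d)) //; last exact: connect_root.
    apply: wR; apply: imset_f.
    by rewrite inE /rt root_root //; apply: con_sym.
  rewrite -[k]enum_valK; case: (enum_val k) => [x|m].
    exact: (g0 (inl (x, true), true)).
  exact: (g0 (inr m, true)).
rewrite -card_sum; apply: leq_trans H _; rewrite mxrank_tr leq_add2l.
apply: leq_trans (leq_imset_card _ _) _; rewrite ncompE cardsE.
by apply: subset_leq_card; apply/subsetP.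
Qed.

Lemma sum_darts (G : T -> 'F_2) :
  \sum_p (G (p, false) + G (s p, true)) = \sum_d G d.
Proof.
rewrite big_split /=.
have -> : \sum_p G (s p, true) = \sum_p G (p, true).
  by rewrite [RHS](reindex_inj (@perm_inj _ s)).
rewrite -big_split /= (eq_bigr (fun p => \sum_b G (p, b))) => [|p _]; last first.
  by rewrite big_bool addrC.
by rewrite pair_bigA; apply: eq_bigr => [[]].
Qed.

(** The boundary of a boundary: [face_step] keeps the face and moves [d] to the vertex of
    [edge s d], so each corner of a face is counted twice. *)
Lemma face_edge_vertex0 : A *m B = 0.
Proof.
apply/matrixP => i k; rewrite !mxE.
pose a (d : T) : 'F_2 := (enum_val i == fr d)%:R.
pose b (d : T) : 'F_2 := (enum_val k == vertex d.1)%:R.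
rewrite (reindex _ (onW_bij _ (@enum_rank_bij _))) /=.
transitivity (\sum_p (a (p, false) * (b (p, false) + b (edge s (p, false)))
   + a (s p, true) * (b (s p, true) + b (edge s (s p, true))))).
  apply: eq_bigr => p _; rewrite !mxE enum_rankK -/(a _) -/(a _) /a /b /edge /= permK.
  by rewrite mulrDl [in X in _ + X = _]addrC.
rewrite (sum_darts (fun d => a d * (b d + b (edge s d)))).
under eq_bigr do rewrite mulrDr.
rewrite big_split /= [X in _ + X](eq_bigr (fun d => a (phi d) * b (phi d))).
  by rewrite [X in X + _](reindex_inj (@face_step_inj _ _ s sg)) F2_addxx.
by move=> d _; rewrite /a /b face_root_phi vertex_rot.
Qed.

Lemma card_pts : (#|{: pt X M}| = #|X| + (#|X| + #|M|))%N.
Proof. by rewrite card_sum card_prod card_bool muln2 -addnn addnA. Qed.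

(** With F faces, C components, V = [#|X| + #|M|] vertices and E = [2 #|X| + #|M|] edges, the ranks
    give (F - C) + (V - C) <= E. *)
Lemma Euler_inequality :
  (ncomp (next_rel phi) <= #|X| + 2 * ncomp (crel s sg))%N.
Proof.
have := leq_add rank_face_edge rank_edge_vertex.
have := mulmx0_rank_max face_edge_vertex0.
move: card_pts (\rank A) (\rank B) => /[swap] a /[swap] b -> ab H.
rewrite mul2n -addnn; lia.
Qed.

(* Equality in Euler's inequality makes the rows of [face_edge_mx] span the
   kernel of [edge_vertex_mx]; every vertex has even degree, so the all-one
   vector is in that kernel, hence a sum of faces. *)
Lemma checkerboard : planarb s sg ->
  exists2 chi : T -> bool, (forall d, chi (edge s d) = ~~ chi d)
                         & (forall d, chi (rot sg d) = ~~ chi d).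
Proof.
rewrite planarbE => /eqP F.
have rk : (\rank (kermx B) <= \rank A)%N.
  rewrite mxrank_ker leq_subLR.
  have := leq_add rank_face_edge rank_edge_vertex; rewrite F.
  by move: card_pts (\rank A) (\rank B) => /[swap] a /[swap] b ->; lia.
have AK : (A <= kermx B)%MS by apply/sub_kermxP; exact: face_edge_vertex0.
have KA : (kermx B <= A)%MS by rewrite -(geq_leqif (mxrank_leqif_sup AK)).
have : ((const_mx 1 : 'rV_#|{: pt X M}|) <= A)%MS.
  apply: submx_trans KA; apply/sub_kermxP/rowP => k; rewrite !mxE.
  rewrite (reindex _ (onW_bij _ (@enum_rank_bij _))) /=; pose b (d : T) : 'F_2 := (enum_val k == vertex d.1)%:R.
  transitivity (\sum_(p : pt X M) (b (p, false) + b (s p, true))).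
    by apply: eq_bigr => p _; rewrite !mxE enum_rankK mul1r.
  rewrite big_split /= [X in X + _](reindex_inj (@perm_inj _ s)) /=.
  exact: F2_addxx.
case/submxP => u uA; pose g d := u 0 (enum_rank (fr d)).
(* [g d] is the colour of the face of [d]. All entries of the row being 1, it changes across every
   edge. *)
have gE p : g (s p, true) = 1 + g (p, false).
  have := congr1 (fun v : 'rV_ _ => v 0 (enum_rank p)) uA.
  by rewrite mul_face_edge mxE -/(g _) -/(g _) => ->; rewrite addrAC F2_addxx add0r.
have F1 : forall x : 'F_2, (1 + x == 0) = ~~ (x == 0) by case=> [] [|[|]].
exists (fun d => g d == 0) => [[p b]|d].
  by case: b; rewrite /edge /= ?gE ?F1 // -{2}[p](permKV s) gE F1 negbK.
have E d' : (g (edge s d') == 0) = ~~ (g d' == 0).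
  case: d' => q [] ; rewrite /edge /= ?gE ?F1 //.
  by rewrite -{2}[q](permKV s) gE F1 negbK.
(* [rot sg d] is the [face_step] of [edge s d], hence on the same face as [edge s d]. *)
have -> : g (rot sg d) = g (edge s d).
  by rewrite /g -[in RHS]face_root_phi /face_step edgeK.
exact: E.
Qed.
End Euler.
End LinearAlgebra.

(* [j] parametrises the side [chi] of the colouring. *)
Lemma ncomp_two_involutions (T K : finType) (al be : T -> T) (chi : T -> bool)
    (j : K -> T) (ji : T -> K) (pi : {perm K}) :
  involutive al -> involutive be ->
  (forall d, chi (al d) = ~~ chi d) -> (forall d, chi (be d) = ~~ chi d) ->
  (forall k, chi (j k)) -> cancel j ji -> (forall d, chi d -> j (ji d) = d) ->
  (forall k, j (pi k) = al (be (j k))) ->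
  ncomp (rel_of2 al be) = #|porbits pi|.
Proof.
move=> alK beK cal cbe cj jK jiK jpi; rewrite -ncomp_perm; apply/esym.
have ca d : con (rel_of2 al be) d (al d) by apply: con1; rewrite /rel_of2 /= eqxx.
have cb d : con (rel_of2 al be) d (be d) by apply: con1; rewrite /rel_of2 /= eqxx orbT.
apply: (ncomp_eq_map (h := j) (k := fun d => ji (if chi d then d else al d))).
- by move=> x y /eqP->; rewrite jpi; apply: connect_trans (cb _) (ca _).
- by move=> d; case: ifP => cd; rewrite jiK ?cal ?cd.
- move=> d e /orP[]/eqP->.
    by rewrite cal; case: (chi d); rewrite /= ?alK; apply: connect0.
  rewrite cbe; case cd: (chi d) => /=.
    apply: con1; apply/eqP; apply: (can_inj jK).
    by rewrite jpi !jiK // cal cbe cd.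
  apply: con1r; apply/eqP; apply: (can_inj jK).
  by rewrite jpi !jiK ?cal ?cbe ?cd // beK.
- by move=> k; rewrite cj jK.
Qed.

Lemma odd_porbits (T : finType) (s : {perm T}) :
  odd #|porbits s| = odd #|T| (+) odd_perm s.
Proof. by rewrite /odd_perm addbA addbb. Qed.

(** * The parity of the number of circles *)

Section Parity.
Variables (X M : finType) (s : {perm pt X M}) (sg : X -> bool).

Definition seifert (d : dart X M) : dart X M :=
  match d.1 with
  | inl (x, ov) => (inl (x, ~~ ov), ~~ d.2)
  | inr m => (inr m, ~~ d.2)
  end.

Definition other_strand (w : pt X M) : pt X M :=
  match w with inl (x, ov) => inl (x, ~~ ov) | inr m => inr m end.

Lemma other_strandK : involutive other_strand.
Proof. by case=> [[x ov]|m] //=; rewrite negbK. Qed.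

Definition other_perm := perm (inv_inj other_strandK).

Lemma seifertK : involutive seifert.
Proof. by case=> [[[x ov]|m] b]; rewrite /seifert /= ?negbK. Qed.

(* With the checkerboard colouring, both smoothings are products of
   permutations of the coloured half-edges that differ by one transposition
   at each crossing. *)
Lemma ntau_parity : planarb s sg ->
  odd (ncomp (rel_of2 (@smooth X M) (edge s))) = odd (ncomp (next_rel s)).
Proof.
case/checkerboard => chi ce cr.
(* Opposite half-edges at a crossing belong to the same strand, so alternation means that the
   coloured ones are the two half-edges of a single strand; [w x] says whether it is the upper
   one. *)
pose w x := chi (inl (x, true), true).
have cx x ov b : chi (inl (x, ov), b) = (ov == w x).
  have := cr (inl (x, true), true); have := cr (inl (x, true), false).
  have := cr (inl (x, false), true); have := cr (inl (x, false), false).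
  rewrite /w /rot /=; case: (sg x); case: ov; case: b => /=;
  move: (chi (inl (x, true), true)) (chi (inl (x, true), false))
    (chi (inl (x, false), true)) (chi (inl (x, false), false)); do 4!case=> //.
pose h m := chi (inr m, true).
have cm m b : chi (inr m, b) = (b == h m).
  by case: b; rewrite /h ?eqb_id //; have := cr (inr m, true); rewrite /rot /= => ->.
(* A crossing has two coloured half-edges and a marker one, so the points can parametrise them; the
   boolean of a point is reused for the direction of the half-edge. *)
pose j (p : pt X M) : dart X M :=
  match p with inl (x, b) => (inl (x, w x), b) | inr m => (inr m, h m) end.
pose ji (d : dart X M) : pt X M :=
  match d.1 with inl (x, _) => inl (x, d.2) | inr m => inr m end.
have cj k : chi (j k) by case: k => [[x b]|m] /=; rewrite ?cx ?cm eqxx.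
have jK : cancel j ji by case=> [[x b]|m].
have jiK d : chi d -> j (ji d) = d.
  by case: d => [[[x ov]|m] b]; rewrite /ji /= ?cx ?cm => /eqP->.
have csm d : chi (smooth d) = ~~ chi d.
  case: d => [[[x ov]|m] b]; rewrite /smooth /= ?cx ?cm.
    by case: ov; case: (w x).
  by case: b; case: (h m).
have cse d : chi (seifert d) = ~~ chi d.
  case: d => [[[x ov]|m] b]; rewrite /seifert /= ?cx ?cm.
    by case: ov; case: (w x).
  by case: b; case: (h m).
pose f k := ji (seifert (edge s (j k))).
have fE k : j (f k) = seifert (edge s (j k)) by rewrite jiK // cse ce cj.
have finj : injective f.
  move=> k k' kk'; apply: (can_inj jK); apply: (inv_inj (edgeK s)).
  by apply: (inv_inj seifertK); rewrite -!fE kk'.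
have -> : ncomp (rel_of2 (@smooth X M) (edge s)) = #|porbits (perm finj * other_perm)%g|.
  apply: (ncomp_two_involutions (j := j) (ji := ji) (chi := chi)) => //.
  - exact: smoothK.
  - exact: edgeK.
  - move=> k; rewrite permM !permE; move: (fE k) => /(congr1 seifert).
    rewrite seifertK => <-; case: (f k) => [[x b]|m] //=.
      by rewrite /smooth /seifert /= !negbK.
    by rewrite /smooth /seifert /= negbK.
rewrite ncomp_perm !odd_porbits; congr addb.
have E1 : ncomp (rel_of2 seifert (edge s)) = #|porbits (perm finj)|.
  apply: (ncomp_two_involutions (j := j) (ji := ji) (chi := chi)) => //.
  - exact: seifertK.
  - exact: edgeK.
  - by move=> k; rewrite permE.
(* The Seifert smoothing reverses directions as well, so the outgoing half-edges are a second
   admissible side for it. The incoherent smoothing preserves directions and has only the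
   checkerboard sides. *)
have E2 : ncomp (rel_of2 seifert (edge s)) = #|porbits (s * other_perm)%g|.
  apply: (ncomp_two_involutions (j := fun p => (p, false)) (ji := fun d => d.1)
           (chi := fun d => ~~ d.2)) => //.
  - exact: seifertK.
  - exact: edgeK.
  - by case=> [[[x ov]|m] b].
  - by case=> p [].
  - by case=> p [].
  - by move=> k; rewrite permM permE /edge /=; case: (s k) => [[]|].
(* Two permutations of the same set with equally many cycles have the same sign. *)
have E : odd_perm (perm finj) = odd_perm (s * other_perm)%g.
  by apply: (@addbI (odd #|{: pt X M}|)); rewrite -!odd_porbits -E1 E2.
by rewrite odd_permM E odd_permM -addbA addbb addbF.
Qed.
End Parity.

(** * Invariance of the number of components *)

Lemma con_next (T : finType) (s : T -> T) x : con (next_rel s) x (s x).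
Proof. by apply: con1; apply: eqxx. Qed.

(** In the typical use [s'] arises by inserting points into cycles of [s], and [k] moves a new point
    back to an old point of its cycle. *)
Lemma ncomp_insert (T T' : finType) (s : T -> T) (s' : T' -> T') (h : T -> T')
    (k : T' -> T) :
  cancel h k ->
  (forall y, con (next_rel s) (k y) (k (s' y))) ->
  (forall x, con (next_rel s') (h x) (h (s x))) ->
  (forall y, con (next_rel s') y (h (k y))) ->
  ncomp (next_rel s) = ncomp (next_rel s').
Proof.
move=> hK ks hs hk; apply: (ncomp_eq_map (h := h) (k := k)) => //.
- by move=> x y /eqP->; apply: hs.
- by move=> x y /eqP->; apply: ks.
- by move=> x; rewrite hK; apply: connect0.
Qed.

(** [k0] prescribes where the points outside the image of [h] go: to the old point after which they
    were inserted. *)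
Lemma exists_retract (T T' : finType) (h : T -> T') (k0 : T' -> T) : injective h ->
  exists k : T' -> T, cancel h k /\ (forall y, (forall x, h x != y) -> k y = k0 y).
Proof.
move=> hinj; exists (fun y => odflt (k0 y) [pick z | h z == y]); split=> [x|y ny].
  by case: pickP => [z /eqP/hinj|/(_ x)/eqP].
by case: pickP => [z /eqP hz|//]; case/eqP: (ny z).
Qed.

Lemma liftp_inj (X X' M M' : finType) (f : X -> X') (g : M -> M') :
  injective f -> injective g -> injective (liftp f g).
Proof. by move=> fi gi [[x b]|m] [[x' b']|m'] //= [] => [/fi-> ->|/gi->]. Qed.

Lemma bool_neq (a b : bool) : b != a -> b = ~~ a.
Proof. by case: a b => [] []. Qed.

Lemma ncomponents_iso D D' : move_iso D D' -> ncomponents D = ncomponents D'.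
Proof.
case=> f [g] [[f' fK f'K] [g' gK g'K] _ sfg].
apply: (ncomp_insert (h := liftp f g) (k := liftp f' g')).
- by case=> [[x b]|m] /=; rewrite ?fK ?gK.
- move=> y; have -> : y = liftp f g (liftp f' g' y).
    by case: y => [[x b]|m] /=; rewrite ?f'K ?g'K.
  rewrite sfg; have K : cancel (liftp f g) (liftp f' g').
    by case=> [[x b]|m] /=; rewrite ?fK ?gK.
  by rewrite !K; apply: con_next.
- by move=> x; rewrite -sfg; apply: con_next.
- by case=> [[x b]|m] /=; rewrite ?f'K ?g'K; apply: connect0.
Qed.

Lemma ncomponents_marker D D' : move_marker D D' -> ncomponents D = ncomponents D'.
Proof.
case=> f [g] [m0] [p] [[[f' fK f'K] gi gm0 gsurj _] [s1 s2 s3]].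
have hi : injective (liftp f g) := liftp_inj (can_inj fK) gi.
have [k [hK knew]] := exists_retract (fun=> p) hi.
have hne r : liftp f g r != inr m0.
  by case: r => [[]|m] //=; apply: contra (gm0 m) => /eqP[->].
have km0 : k (inr m0) = p by apply: knew => r; apply: hne.
have cov y : y = inr m0 \/ exists r, y = liftp f g r.
  case: y => [[x b]|m]; first by right; exists (inl (f' x, b)); rewrite /= f'K.
  by case: (gsurj m) => [->|[m' ->]]; [left|right; exists (inr m')].
have c' := con_next (succ D').
have cp : con (next_rel (succ D')) (inr m0) (liftp f g p).
  by rewrite con_sym -s2; apply: c'.
apply: (ncomp_insert (h := liftp f g) (k := k)) => //.
- move=> y; case: (cov y) => [->|[r ->]].
    by rewrite s3 km0 hK; apply: con_next.
  case: (eqVneq r p) => [->|rp]; first by rewrite s2 hK km0; apply: connect0.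
  by rewrite s1 // !hK; apply: con_next.
- move=> r; case: (eqVneq r p) => [->|rp]; last by rewrite -s1 //; apply: c'.
  by rewrite -s3 -s2; apply: connect_trans (c' _) (c' _).
- move=> y; case: (cov y) => [->|[r ->]]; first by rewrite km0.
  by rewrite hK; apply: connect0.
Qed.

Lemma ncomponents_R1 D D' : move_R1 D D' -> ncomponents D = ncomponents D'.
Proof.
case=> f [g] [c] [p] [a] [[fi fc fsurj [g' gK g'K] _] [s1 s2 s3 s4]].
have hi : injective (liftp f g) := liftp_inj fi (can_inj gK).
have [k [hK knew]] := exists_retract (fun=> p) hi.
have kc b : k (inl (c, b)) = p.
  by apply: knew => [[[x ov]|m]] //=; apply: contra (fc x) => /eqP[-> _].
have cov y : (exists b, y = inl (c, b)) \/ exists r, y = liftp f g r.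
  case: y => [[x b]|m]; last by right; exists (inr (g' m)); rewrite /= g'K.
  by case: (fsurj x) => [->|[x' ->]]; [left; exists b|right; exists (inl (x', b))].
have c' := con_next (succ D').
have ca : con (next_rel (succ D')) (inl (c, a)) (liftp f g p).
  by rewrite con_sym -s2; apply: c'.
have cb b : con (next_rel (succ D')) (inl (c, b)) (liftp f g p).
  case: (eqVneq b a) => [->//|/bool_neq->].
  by apply: connect_trans ca; rewrite con_sym -s3; apply: c'.
apply: (ncomp_insert (h := liftp f g) (k := k)) => //.
- move=> y; case: (cov y) => [[b ->]|[r ->]].
    rewrite kc; case: (eqVneq b a) => [->|]; first by rewrite s3 kc; apply: connect0.
    by move/bool_neq->; rewrite s4 hK; apply: con_next.
  case: (eqVneq r p) => [->|rp]; first by rewrite s2 hK kc; apply: connect0.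
  by rewrite s1 // !hK; apply: con_next.
- move=> r; case: (eqVneq r p) => [->|rp]; last by rewrite -s1 //; apply: c'.
  by rewrite -s4; apply: connect_trans (c' _); rewrite con_sym; apply: cb.
- move=> y; case: (cov y) => [[b ->]|[r ->]]; first by rewrite kc.
  by rewrite hK; apply: connect0.
Qed.

Lemma ncomponents_R2 D D' : move_R2 D D' -> ncomponents D = ncomponents D'.
Proof.
case=> f [g] [c1] [c2] [p] [q] [t] [o] /=.
set d1 := if o then c1 else c2; set d2 := if o then c2 else c1.
case=> [[fi c12 fc fsurj [g' gK g'K]] [[_ _ pq] [[s1 s2 s3 s4] [s5 s6 s7]]]].
have hi : injective (liftp f g) := liftp_inj fi (can_inj gK).
(* The passages of type [t] lie on the edge leaving [p], the others on that leaving [q]. *)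
pose k0 (y : pt (crs D') (mrk D')) := if y is inl (_, b) then if b == t then p else q else p.
have [k [hK knew]] := exists_retract k0 hi.
have kc c b : (c == c1) || (c == c2) -> k (inl (c, b)) = if b == t then p else q.
  move=> cc; apply: knew => [[[x ov]|m]] //=; have [n1 n2] := fc x.
  by apply/eqP=> -[xc _]; move: cc; rewrite -xc (negPf n1) (negPf n2).
have k1 b : k (inl (c1, b)) = if b == t then p else q by rewrite kc ?eqxx.
have k2 b : k (inl (c2, b)) = if b == t then p else q by rewrite kc ?eqxx ?orbT.
have kd1 : k (inl (d1, ~~ t)) = q.
  by rewrite kc; [case: (t)|rewrite /d1; case: ifP; rewrite eqxx ?orbT].
have kd2 : k (inl (d2, ~~ t)) = q.
  by rewrite kc; [case: (t)|rewrite /d2; case: ifP; rewrite eqxx ?orbT].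
have k1t : k (inl (c1, t)) = p by rewrite k1 eqxx.
have k2t : k (inl (c2, t)) = p by rewrite k2 eqxx.
have cov y : [\/ y \in [:: inl (c1, t); inl (c2, t)], y \in [:: inl (d1, ~~ t); inl (d2, ~~ t)]
                | exists r, y = liftp f g r].
  case: y => [[x b]|m]; last by apply: Or33; exists (inr (g' m)); rewrite /= g'K.
  case: (fsurj x) => [->|->|[x' ->]]; last by apply: Or33; exists (inl (x', b)).
    case: (eqVneq b t) => [->|]; first by apply: Or31; rewrite !inE eqxx.
    move/bool_neq->; apply: Or32; rewrite /d1 /d2.
    by case: (o); rewrite !inE eqxx ?orbT.
  case: (eqVneq b t) => [->|]; first by apply: Or31; rewrite !inE eqxx orbT.
  move/bool_neq->; apply: Or32; rewrite /d1 /d2.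
  by case: (o); rewrite !inE eqxx ?orbT.
have c' := con_next (succ D').
have e1 : con (next_rel (succ D')) (liftp f g p) (inl (c1, t)) by rewrite -s2; apply: c'.
have e2 : con (next_rel (succ D')) (liftp f g p) (inl (c2, t)).
  by apply: connect_trans e1 _; rewrite -s3; apply: c'.
have e3 : con (next_rel (succ D')) (liftp f g q) (inl (d1, ~~ t)) by rewrite -s5; apply: c'.
have e4 : con (next_rel (succ D')) (liftp f g q) (inl (d2, ~~ t)).
  by apply: connect_trans e3 _; rewrite -s6; apply: c'.
apply: (ncomp_insert (h := liftp f g) (k := k)) => //.
- move=> y; case: (cov y) => [||[r ->]].
  + rewrite !inE => /orP[]/eqP->; first by rewrite s3 k1t k2t; apply: connect0.
    by rewrite s4 k2t hK; apply: con_next.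
  + rewrite !inE => /orP[]/eqP->; first by rewrite s6 kd1 kd2; apply: connect0.
    by rewrite s7 kd2 hK; apply: con_next.
  case: (eqVneq r p) => [->|rp]; first by rewrite s2 hK k1t; apply: connect0.
  case: (eqVneq r q) => [->|rq]; first by rewrite s5 hK kd1; apply: connect0.
  by rewrite s1 // !hK; apply: con_next.
- move=> r; case: (eqVneq r p) => [->|rp].
    by rewrite -s4; apply: connect_trans e2 (c' _).
  case: (eqVneq r q) => [->|rq]; last by rewrite -s1 //; apply: c'.
  by rewrite -s7; apply: connect_trans e4 (c' _).
- move=> y; rewrite con_sym; case: (cov y) => [||[r ->]].
  + by rewrite !inE => /orP[]/eqP->; rewrite ?k1t ?k2t.
  + by rewrite !inE => /orP[]/eqP->; rewrite ?kd1 ?kd2.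
  by rewrite hK; apply: connect0.
Qed.

Lemma swap2_tperm (T : finType) (a b r : T) : swap2 a b r = tperm a b r.
Proof. by rewrite /swap2 permE. Qed.

Lemma tperm_tpermC (T : finType) (a b c d : T) x : uniq [:: a; b; c; d] ->
  tperm a b (tperm c d x) = tperm c d (tperm a b x).
Proof.
rewrite /= !inE !negb_or => /and4P[/and3P[_ ac ad] /andP[bc bd] _ _].
by rewrite -!permM conjgC tpermJ !tpermD // eq_sym.
Qed.

Lemma swap_threeK (T : finType) (a b c d e f : T) :
  uniq [:: a; b; c; d; e; f] ->
  involutive (fun r => swap2 a b (swap2 c d (swap2 e f r))).
Proof.
move=> u r; rewrite !swap2_tperm.
have C12 x : tperm c d (tperm a b x) = tperm a b (tperm c d x).
  rewrite -tperm_tpermC //.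
  by apply: subseq_uniq (mask_subseq [:: true; true; true; true] _) u.
have C13 x : tperm e f (tperm a b x) = tperm a b (tperm e f x).
  rewrite -tperm_tpermC //.
  by apply: subseq_uniq (mask_subseq [:: true; true; false; false; true; true] _) u.
have C23 x : tperm e f (tperm c d x) = tperm c d (tperm e f x).
  rewrite -tperm_tpermC //.
  by apply: subseq_uniq (mask_subseq [:: false; false; true; true; true; true] _) u.
by rewrite C13 C12 tpermK C23 !tpermK.
Qed.

Lemma ncomponents_R3 D D' : move_R3 D D' -> ncomponents D = ncomponents D'.
Proof.
case=> f [g] [x] [y] [z] [oT] [oM] [oB] /=.
case=> [[[f' fK f'K] [g' gK g'K] _ /and3P[xy yz xz]] [_ _ _ _ sD]].
pose sw (r : pt (crs D) (mrk D)) := swap2 (inl (x, true)) (inl (y, true))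
  (swap2 (inl (x, false)) (inl (z, true)) (swap2 (inl (y, false)) (inl (z, false)) r)).
have swK : involutive sw.
  apply: swap_threeK; rewrite /= !inE.
  have E a b (u v : crs D) : ((inl (u, a) : pt (crs D) (mrk D)) == inl (v, b)) = (u == v) && (a == b) by [].
  rewrite !E /= !andbT !andbF !orbF /=.
  by rewrite yz (negPf xy) (negPf xz).
pose h := liftp f g \o sw; pose k := sw \o liftp f' g'.
have lK : cancel (liftp f g) (liftp f' g') by case=> [[u b]|m] /=; rewrite ?fK ?gK.
have lK' : cancel (liftp f' g') (liftp f g) by case=> [[u b]|m] /=; rewrite ?f'K ?g'K.
(* Up to relabelling, the move conjugates the successor by the involution [sw], so [h] carries
   cycles to cycles. *)
have sh r : succ D' (h r) = h (succ D r) by rewrite /h /= sD -!/(sw _) swK.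
apply: (ncomp_insert (h := h) (k := k)).
- by move=> r; rewrite /h /k /= lK swK.
- move=> r; have -> : r = h (k r) by rewrite /h /k /= swK lK'.
  by rewrite sh /h /k /= !lK !swK; apply: con_next.
- by move=> r; rewrite -sh; apply: con_next.
- by move=> r; rewrite /h /k /= swK lK'; apply: connect0.
Qed.

Lemma ncomponents_equiv D D' : link_equiv D D' -> ncomponents D = ncomponents D'.
Proof.
elim=> // [D1 D2 []|D1 D2 D3 _ -> _ ->] //.
- exact: ncomponents_iso.
- exact: ncomponents_marker.
- exact: ncomponents_R1.
- by case; [exact: ncomponents_R2|exact: ncomponents_R3].
Qed.

(** * Invariants and maps of circles and faces *)

Section Links.
Variables (X M : finType) (s : {perm pt X M}) (sg : X -> bool).

Definition trel : rel (dart X M) := rel_of2 (@smooth X M) (edge s).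

Lemma con_trel_edge w : con trel (w, false) (s w, true).
Proof. by apply: con1; rewrite /trel /rel_of2 /= eqxx orbT. Qed.

Lemma con_trel_smooth d : con trel d (smooth d).
Proof. by apply: con1; rewrite /trel /rel_of2 /= eqxx. Qed.

Lemma con_crel_edge w : con (crel s sg) (w, false) (s w, true).
Proof. exact: (con_edge s sg (w, false)). Qed.

Lemma trel_const (K : Type) (f : dart X M -> K) d e :
  (forall w, f (s w, true) = f (w, false)) -> (forall d, f (smooth d) = f d) ->
  con trel d e -> f d = f e.
Proof.
move=> fe fs; apply: con_const=> {}d {}e /orP[]/eqP->; first by rewrite fs.
by case: d => w []; rewrite /edge /= -?fe // permKV.
Qed.

Lemma next_face_const (K : Type) (f : dart X M -> K) :
  (forall w, f (rot sg (s w, true)) = f (w, false)) ->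
  (forall w, f (rot sg (w, false)) = f (s w, true)) ->
  forall d e, next_rel (face_step s sg) d e -> f d = f e.
Proof.
move=> f1 f2 [w b] e /eqP->; case: b; rewrite /face_step /edge /= ?f1 // f2.
by rewrite permKV.
Qed.

Lemma trel_crel d e : con trel d e -> con (crel s sg) d e.
Proof.
apply: (con_map (h := id)) => {}d {}e /orP[]/eqP->; last exact: con_edge.
by apply: con_vertex; case: d => [[[x ov]|m] b].
Qed.

Lemma planarbI : #|X| + 2 * ncomp (crel s sg) <= ncomp (next_rel (face_step s sg)) ->
  planarb s sg.
Proof. by move=> H; rewrite planarbE eqn_leq H Euler_inequality. Qed.
End Links.

Lemma trel_map (X X' M M' : finType) (s : {perm pt X M}) (s' : {perm pt X' M'})
    (h : dart X M -> dart X' M') :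
  (forall w, con (trel s') (h (w, false)) (h (s w, true))) ->
  (forall d, con (trel s') (h d) (h (smooth d))) ->
  forall d e, trel s d e -> con (trel s') (h d) (h e).
Proof.
move=> he hs d e /orP[]/eqP-> //.
case: d => w []; rewrite /edge /= // -{1}(permKV s w).
by rewrite con_sym.
Qed.

Lemma crel_map (X X' M M' : finType) (s : {perm pt X M}) (s' : {perm pt X' M'})
    (sg : X -> bool) (sg' : X' -> bool) (h : dart X M -> dart X' M') :
  (forall w, con (crel s' sg') (h (w, false)) (h (s w, true))) ->
  (forall d, con (crel s' sg') (h d) (h (rot sg d))) ->
  forall d e, crel s sg d e -> con (crel s' sg') (h d) (h e).
Proof.
move=> he hs d e /orP[]/eqP-> //.
case: d => w []; rewrite /edge /= // -{1}(permKV s w).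
by rewrite con_sym.
Qed.

(** * Inserting a kink and a parallel clasp *)

Section Extension.
Variables (X Y M : finType).

Definition oldp : pt X M -> pt (X + Y)%type M := liftp inl id.
Definition oldd (d : dart X M) : dart (X + Y)%type M := (oldp d.1, d.2).

Lemma oldp_inj : injective oldp.
Proof. by apply: liftp_inj => // ? ? []. Qed.

Lemma oldp_eq p q : (oldp p == oldp q) = (p == q).
Proof. exact: inj_eq oldp_inj _ _. Qed.

Lemma oldp_new p y b : (oldp p == inl (inr y, b)) = false.
Proof. by case: p => [[]|]. Qed.

Lemma new_oldp p y b : (inl (inr y, b) == oldp p) = false.
Proof. by case: p => [[]|]. Qed.

Definition oldpE := (oldp_eq, oldp_new, new_oldp).

Variant pt_ext_spec : pt (X + Y)%type M -> Type :=
  | PtOld p : pt_ext_spec (oldp p)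
  | PtNew y b : pt_ext_spec (inl (inr y, b)).

Lemma pt_extP r : pt_ext_spec r.
Proof.
case: r => [[[x|y] b]|m]; [|by right|].
  exact: (PtOld (inl (x, b))).
exact: (PtOld (inr m)).
Qed.

Lemma oldd_rot (sg : X -> bool) (sg' : X + Y -> bool) d :
  (forall x, sg' (inl x) = sg x) -> rot sg' (oldd d) = oldd (rot sg d).
Proof. by move=> E; case: d => [[[x []]|m] b]; rewrite /rot /= ?E. Qed.

Lemma oldd_smooth d : smooth (oldd d) = oldd (smooth d).
Proof. by case: d => [[[x ov]|m] b]. Qed.

Variable s : {perm pt X M}.

Definition ext_fun (t : {perm pt X M}) (r : pt (X + Y)%type M) : pt (X + Y)%type M :=
  match r with
  | inl (inl x, b) => oldp (t (inl (x, b)))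
  | inl (inr y, b) => r
  | inr m => oldp (t (inr m))
  end.

Lemma ext_fun_oldp t p : ext_fun t (oldp p) = oldp (t p).
Proof. by case: p => [[x b]|m]. Qed.

Lemma ext_funK : cancel (ext_fun s) (ext_fun s^-1).
Proof. by move=> r; case: (pt_extP r) => [p|y b] //=; rewrite !ext_fun_oldp permK. Qed.

Definition ext_perm := perm (can_inj ext_funK).

Lemma ext_perm_oldp p : ext_perm (oldp p) = oldp (s p).
Proof. by rewrite permE ext_fun_oldp. Qed.

Lemma ext_perm_new y b : ext_perm (inl (inr y, b)) = inl (inr y, b).
Proof. by rewrite permE. Qed.
End Extension.
Arguments oldp {X} Y {M} p.
Arguments oldd {X} Y {M} d.

Section InsertPerm.
Variables (X M : finType) (s : {perm pt X M}).

(* Multiplying by [tperm p c] on the left inserts the fixed point [c] right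
   after [p] in its cycle. *)
Definition R1_perm (p : pt X M) : {perm pt (X + unit)%type M} :=
  (tperm (oldp _ p) (inl (inr tt, true)) *
   (tperm (oldp _ p) (inl (inr tt, false)) * ext_perm _ s))%g.

Lemma R1_permE p :
  [/\ forall w, w != p -> R1_perm p (oldp _ w) = oldp _ (s w),
      R1_perm p (oldp _ p) = inl (inr tt, true),
      R1_perm p (inl (inr tt, true)) = inl (inr tt, false) &
      R1_perm p (inl (inr tt, false)) = oldp _ (s p)].
Proof.
have tE (a b x : pt (X + unit) M) :
  tperm a b x = if x == a then b else if x == b then a else x by rewrite permE.
have simp := (tE, oldpE, eqxx, ext_perm_oldp, ext_perm_new).
split=> [w wp|||]; rewrite /R1_perm !permM; first by rewrite !(simp, negPf wp).
all: by rewrite !simp.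
Qed.

(* The strand [l] passes under the parallel strand [r], lying to its right, at
   [inr true] and then at [inr false]. *)
Definition R2_perm (l r : pt X M) : {perm pt (X + bool)%type M} :=
  (tperm (oldp _ l) (inl (inr true, false)) *
   (tperm (oldp _ r) (inl (inr true, true)) *
   (tperm (oldp _ l) (inl (inr false, false)) *
   (tperm (oldp _ r) (inl (inr false, true)) * ext_perm _ s))))%g.

Lemma R2_permE l r : l != r ->
  [/\ forall w, w != l -> w != r -> R2_perm l r (oldp _ w) = oldp _ (s w),
   [/\ R2_perm l r (oldp _ l) = inl (inr true, false),
      R2_perm l r (inl (inr true, false)) = inl (inr false, false) &
      R2_perm l r (inl (inr false, false)) = oldp _ (s l)] &
   [/\ R2_perm l r (oldp _ r) = inl (inr true, true),
      R2_perm l r (inl (inr true, true)) = inl (inr false, true) &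
      R2_perm l r (inl (inr false, true)) = oldp _ (s r)]].
Proof.
move=> lr; have rl : r != l by rewrite eq_sym.
have E : forall w, R2_perm l r w = ext_perm _ s (tperm (oldp _ r) (inl (inr false, true))
  (tperm (oldp _ l) (inl (inr false, false)) (tperm (oldp _ r) (inl (inr true, true))
  (tperm (oldp _ l) (inl (inr true, false)) w)))) by move=> w; rewrite !permM.
have tE (a b x : pt (X + bool) M) :
  tperm a b x = if x == a then b else if x == b then a else x by rewrite permE.
have simp := (tE, oldpE, eqxx, negPf lr, negPf rl, ext_perm_oldp, ext_perm_new).
split=> [w wl wr||]; first by rewrite E !(simp, negPf wl, negPf wr).
all: by split; rewrite E !simp.
Qed.
End InsertPerm.

Section ExtDartFun.
Variables (X Y M : finType) (K : Type) (fo : dart X M -> K) (fn : Y -> bool -> bool -> K).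

Definition ext_dart_fun (d : dart (X + Y)%type M) : K :=
  match d.1 with
  | inl (inl x, b) => fo (inl (x, b), d.2)
  | inl (inr y, b) => fn y b d.2
  | inr m => fo (inr m, d.2)
  end.

Lemma ext_dart_fun_old w b : ext_dart_fun (oldp Y w, b) = fo (w, b).
Proof. by case: w => [[x ov]|m]. Qed.

Lemma ext_dart_fun_oldd d : ext_dart_fun (oldd Y d) = fo d.
Proof. by rewrite ext_dart_fun_old -surjective_pairing. Qed.

Lemma ext_dart_fun_smooth d :
  (forall d, fo (smooth d) = fo d) -> (forall y b c, fn y (~~ b) c = fn y b c) ->
  ext_dart_fun (smooth d) = ext_dart_fun d.
Proof.
move=> Ho Hn; case: d => [[[[x|y] ov]|m] b]; rewrite /ext_dart_fun /= ?Hn //.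
  by rewrite -[RHS]Ho.
by rewrite -[RHS]Ho.
Qed.
End ExtDartFun.

Lemma trel_root (X M : finType) (s : {perm pt X M}) d e :
  con (trel s) d e = (root (sym_rel (trel s)) d == root (sym_rel (trel s)) e).
Proof. by rewrite root_connect //; apply: con_sym. Qed.

Lemma trel_root_edge (X M : finType) (s : {perm pt X M}) w :
  root (sym_rel (trel s)) (s w, true) = root (sym_rel (trel s)) (w, false).
Proof. by apply/eqP; rewrite -trel_root con_sym con_trel_edge. Qed.

Lemma trel_root_smooth (X M : finType) (s : {perm pt X M}) d :
  root (sym_rel (trel s)) (smooth d) = root (sym_rel (trel s)) d.
Proof. by apply/eqP; rewrite -trel_root con_sym con_trel_smooth. Qed.

(** The value [None] is reserved for a face created by a move; the old faces keep their roots as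
    values. *)
Lemma Some_roots_ge (T T' : finType) (r : rel T) (r' : rel T') (f : T' -> option T) :
  (forall x y, r' x y -> f x = f y) -> (exists y, f y = None) ->
  (forall x, root (sym_rel r) x = x -> exists y, f y = Some x) ->
  (ncomp r).+1 <= ncomp r'.
Proof.
move=> fr fN fS.
have -> : (ncomp r).+1 = #|None |: [set Some x | x in roots (sym_rel r)]|.
  rewrite cardsU1 card_imset; last by move=> ? ? [].
  by rewrite -ncompE (_ : None \notin _) //; apply/imsetP => -[].
apply: (ncomp_ge_const (f := f)) => // a; rewrite !inE => /orP[/eqP->//|].
by case/imsetP => x /eqP rx ->; apply: fS.
Qed.

Section R1.
Variables (X M : finType) (s : {perm pt X M}) (sg : X -> bool) (p : pt X M) (b : bool).

Definition R1_sgn (x : X + unit) : bool := if x is inl x then sg x else b.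
Local Notation s1 := (R1_perm s p).
Local Notation old := (oldp unit).
Local Notation c ov := (inl (inr tt, ov)).

Lemma R1_crel_edge w :
  con (crel s1 R1_sgn) (old w, false) (old (s w), true).
Proof.
have [s1w s1p s1t s1f] := R1_permE s p.
have cE := con_crel_edge s1 R1_sgn.
case: (eqVneq w p) => [->|wp]; last by rewrite -s1w //; apply: cE.
apply: connect_trans (cE _) _; rewrite s1p -s1f.
by apply: connect_trans _ (cE _); apply: con_vertex.
Qed.

Lemma R1_crel : ncomp (crel s1 R1_sgn) <= ncomp (crel s sg).
Proof.
have [s1w s1p s1t s1f] := R1_permE s p.
have := @ncomp_le_map _ _ (crel s sg) (crel s1 R1_sgn) (oldd unit) set0.
rewrite cards0 addn0; apply.
  apply: crel_map => [w|d]; first exact: R1_crel_edge.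
  by rewrite -(oldd_rot (sg' := R1_sgn)) //; apply: con_rot.
move=> [w d]; left; case: (pt_extP w) => [q|[] ov]; first by exists (q, d); apply: connect0.
exists (p, false); rewrite con_sym; apply: connect_trans (con_crel_edge _ _ _) _.
by rewrite s1p; apply: con_vertex.
Qed.

Lemma R1_planar : planarb s sg -> planarb s1 R1_sgn.
Proof.
have [s1w s1p s1t s1f] := R1_permE s p.
rewrite planarbE => /eqP F; apply: planarbI; rewrite card_sum card_unit.
have fr_out w : face_root s sg (rot sg (s w, true)) = face_root s sg (w, false).
  exact: (face_root_phi s sg (w, false)).
have fr_in w : face_root s sg (rot sg (w, false)) = face_root s sg (s w, true).
  by have := face_root_phi s sg (s w, true); rewrite /face_step /edge /= permK.
(* [None] is the inside of the loop, which meets a single half-edge, chosen by the sign [b]. The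
   other new half-edges lie on the two faces beside the old edge. *)
pose fn (_ : unit) ov d : option (dart X M) :=
  if ov then if ~~ b && ~~ d then None else Some (face_root s sg (s p, true))
  else if b && d then None else Some (face_root s sg (p, false)).
pose f := ext_dart_fun (fun d => Some (face_root s sg d)) fn.
have fo w d : f (old w, d) = Some (face_root s sg (w, d)) by exact: ext_dart_fun_old.
have ro w d : f (rot R1_sgn (old w, d)) = Some (face_root s sg (rot sg (w, d))).
  have := oldd_rot (sg' := R1_sgn) (sg := sg) (w, d); rewrite /oldd /= => -> //.
  by rewrite fo -surjective_pairing.
apply: leq_trans (_ : (ncomp (next_rel (face_step s sg))).+1 <= _).
  by rewrite F; have := R1_crel; lia.
apply: (Some_roots_ge (f := f)).
- apply: next_face_const => w; case: (pt_extP w) => [q|[] ov].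
  + by case: (eqVneq q p) => [->|qp]; [rewrite s1p|rewrite s1w // ro];
      rewrite fo ?fr_out //; rewrite /f /ext_dart_fun /rot /=; case: (b).
  + case: ov; rewrite ?s1t ?s1f ?ro ?fr_out; rewrite /f /ext_dart_fun /rot /=; by case: (b).
  + by case: (eqVneq q p) => [->|qp]; [rewrite s1p|rewrite s1w //];
      rewrite ro fr_in ?fo //; rewrite /f /ext_dart_fun /rot /=; case: (b).
  + case: ov; rewrite ?s1t ?s1f ?fo; rewrite /f /ext_dart_fun /rot /=; by case: (b).
- by exists (c (~~ b), b); rewrite /f /ext_dart_fun /= /fn; case: (b).
- by move=> d rd; exists (oldd unit d); rewrite /oldd fo -surjective_pairing /face_root rd.
Qed.

(** Smoothed incoherently, a kink is a single arc from [p] to [s p] that runs backwards along the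
    loop, so it splits off no circle. *)
Lemma R1_trel_new ov d : con (trel s1) (c ov, d) (oldd unit (p, false)).
Proof.
have [s1w s1p s1t s1f] := R1_permE s p.
have E := con_trel_edge s1.
have S x d0 : con (trel s1) (c x, d0) (c (~~ x), d0) by apply: (con_trel_smooth s1 (c x, d0)).
have e1 : con (trel s1) (c true, true) (oldd unit (p, false)).
  by rewrite con_sym /oldd /= -s1p; apply: E.
have e2 : con (trel s1) (c false, true) (oldd unit (p, false)).
  exact: connect_trans (S false _) e1.
have e3 : con (trel s1) (c true, false) (oldd unit (p, false)).
  by apply: connect_trans (E _) _; rewrite s1t.
have e4 : con (trel s1) (c false, false) (oldd unit (p, false)).
  exact: connect_trans (S false _) e3.
by case: ov d => [] [].
Qed.

Lemma R1_trel d e : con (trel s1) (oldd unit d) (oldd unit e) = con (trel s) d e.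
Proof.
have [s1w s1p s1t s1f] := R1_permE s p.
apply/idP/idP.
  pose rt := root (sym_rel (trel s)).
  pose f := ext_dart_fun rt (fun (_ : unit) (_ _ : bool) => rt (p, false)).
  move=> de; rewrite trel_root -/rt.
  suff : f (oldd unit d) = f (oldd unit e) by rewrite /f !ext_dart_fun_oldd => /eqP.
  apply: trel_const de => [w|d']; last first.
    by apply: ext_dart_fun_smooth => // ?; apply: trel_root_smooth.
  case: (pt_extP w) => [q|[] ov].
    case: (eqVneq q p) => [->|qp]; first by rewrite s1p /f ext_dart_fun_old.
    by rewrite s1w // /f !ext_dart_fun_old /rt trel_root_edge.
  by case: ov; rewrite ?s1t ?s1f /f ?ext_dart_fun_old /rt ?trel_root_edge.
apply: con_map; apply: trel_map => [w|d'].
  case: (eqVneq w p) => [->|wp].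
    rewrite con_sym /oldd /= -s1f; apply: connect_trans (R1_trel_new false false).
    by rewrite con_sym; apply: con_trel_edge.
  by rewrite /oldd /= -s1w //; apply: con_trel_edge.
by rewrite -oldd_smooth; apply: con_trel_smooth.
Qed.

Lemma R1_ntau : ncomp (trel s1) <= ncomp (trel s).
Proof.
have := @ncomp_le_map _ _ (trel s) (trel s1) (oldd unit) set0.
rewrite cards0 addn0; apply; first by move=> x y xy; rewrite R1_trel con1.
move=> [w d]; left; case: (pt_extP w) => [q|[] ov]; first by exists (q, d); apply: connect0.
by exists (p, false); apply: R1_trel_new.
Qed.

Lemma R1_edge d : d != (p, false) -> d != (s p, true) ->
  edge s1 (oldd unit d) = oldd unit (edge s d).
Proof.
have [s1w s1p s1t s1f] := R1_permE s p.
case: d => w [] d1 d2; rewrite /edge /oldd /=; last first.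
  by rewrite s1w //; apply: contra d1 => /eqP->.
congr (_, _); apply: (@perm_inj _ s1); rewrite permKV s1w ?permKV //.
by apply: contra d2 => /eqP<-; rewrite permKV.
Qed.

Lemma R1_face_step d : d != (p, false) -> d != (s p, true) ->
  face_step s1 R1_sgn (oldd unit d) = oldd unit (face_step s sg d).
Proof. by move=> d1 d2; rewrite /face_step R1_edge // (oldd_rot (sg := sg)). Qed.

(* The kink turns the given side of the edge at [p] into the opposite side of
   its loop. *)
Lemma R1_face_step_loop :
  if b then face_step s1 R1_sgn (oldd unit (s p, true)) = (c true, false)
  else face_step s1 R1_sgn (oldd unit (p, false)) = (s1 (c true), true).
Proof.
have [s1w s1p s1t s1f] := R1_permE s p.
rewrite /face_step /edge /oldd /= s1t s1p -s1f permK /rot /= /R1_sgn.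
by case: (b).
Qed.
End R1.

(** * Cutting circles open *)

Lemma even_card_involution (T : finType) (al : T -> T) (K : {set T}) :
  involutive al -> (forall x, al x != x) -> (forall x, x \in K -> al x \in K) ->
  ~~ odd #|K|.
Proof.
move=> alK alN; have [n] := ubnP #|K|; elim: n K => // n IH K Kn Kal.
have [->|[x xK]] := set_0Vmem K; first by rewrite cards0.
have xK' : al x \in K :\ x by rewrite !inE alN Kal.
move: Kn; rewrite (cardsD1 x) xK (cardsD1 (al x)) xK' !add1n /= negbK => Kn.
apply: IH => [|y]; first exact: ltnW.
rewrite !inE => /and3P[yx yax /Kal->]; rewrite andbT.
by rewrite (inj_eq (inv_inj alK)) yax /=; apply: contra yx => /eqP<-; rewrite alK.
Qed.

Section Cut.
Variables (T : finType) (al be : T -> T) (Ra Rb : {set T}).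
Hypotheses (alK : involutive al) (beK : involutive be).
Hypotheses (alN : forall x, al x != x) (beN : forall x, be x != x).
Local Notation r := (rel_of2 al be).
Local Notation r0 := (rel_of2 (fun d => if d \in Ra then d else al d)
                              (fun d => if d \in Rb then d else be d)).

Lemma con_cut_con x y : con r0 x y -> con r x y.
Proof.
apply: (con_map (h := id)) => {}x {}y /orP[]/eqP->; case: ifP => _; try exact: connect0.
  by apply: con1; rewrite /rel_of2 /= eqxx.
by apply: con1; rewrite /rel_of2 /= eqxx orbT.
Qed.

(* Otherwise the component of [x] after the cut would have even cardinality,
   being matched by [be], and odd cardinality, being matched by [al] except at [x]. *)
Lemma con_cut x : x \in Ra ->
  (forall y, con r x y -> y \in Ra -> y = x \/ y = al x) ->
  (forall y, con r x y -> y \notin Rb) -> con r0 x (al x).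
Proof.
move=> xRa uniqRa noRb; apply/negPn/negP => nx.
pose K := [set y | con r0 x y].
have evK : ~~ odd #|K|.
  apply: even_card_involution beK beN _ => y; rewrite !inE => xy.
  apply: (connect_trans xy); apply: con1; rewrite /rel_of2 /=.
  by rewrite (negPf (noRb _ (con_cut_con xy))) eqxx orbT.
have evKx : ~~ odd #|K :\ x|.
  apply: even_card_involution alK alN _ => y; rewrite !inE => /andP[yx xy].
  have yax : y != al x by apply: contraNneq nx => <-.
  have yRa : y \notin Ra.
    by apply/negP => /(uniqRa _ (con_cut_con xy)) [] /eqP; rewrite ?(negPf yx) ?(negPf yax).
  apply/andP; split; first by apply: contraNneq yax => <-; rewrite alK.
  by apply: (connect_trans xy); apply: con1; rewrite /rel_of2 /= (negPf yRa) eqxx.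
by move: evK; rewrite (cardsD1 x) inE connect0 add1n /= (negPf evKx).
Qed.
End Cut.

Lemma con_rel_of2C (T : finType) (f g : T -> T) x y :
  con (rel_of2 f g) x y -> con (rel_of2 g f) x y.
Proof.
by apply: (con_map (h := id)) => {}x {}y H; apply: con1; rewrite /rel_of2 /= orbC.
Qed.

Section TrelCut.
Variables (X M : finType) (s : {perm pt X M}) (Ra Rb : {set dart X M}).
Hypotheses
  (uniqRa : forall d e, d \in Ra -> con (trel s) d e -> e \in Ra -> e = d \/ e = smooth d)
  (uniqRb : forall d e, d \in Rb -> con (trel s) d e -> e \in Rb -> e = d \/ e = edge s d)
  (noRaRb : forall d e, d \in Ra -> con (trel s) d e -> e \notin Rb).

Lemma edgeN d : edge s d != d.
Proof. by apply/eqP => /(congr1 snd); rewrite edge_flip; case: d.2. Qed.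

Lemma smoothN d : smooth d != d :> dart X M.
Proof.
by case: d => [[[x []]|m] []]; apply/eqP => [[]].
Qed.

(** A move destroys some arcs of circles. If each circle loses at most one arc, the rest of it still
    connects the ends, so nothing has to be checked at the arcs in [Ra] (at points) and [Rb] (along
    edges). *)
Lemma trel_cut_map (T : finType) (r : rel T) (h : dart X M -> T) :
  (forall d, d \notin Ra -> con r (h d) (h (smooth d))) ->
  (forall d, d \notin Rb -> con r (h d) (h (edge s d))) ->
  forall d e, trel s d e -> con r (h d) (h e).
Proof.
move=> ha hb d e.
pose r0 := rel_of2 (fun d => if d \in Ra then d else smooth d)
                   (fun d => if d \in Rb then d else edge s d).
suff H : trel s d e -> con r0 d e.
  move/H; apply: con_map => {H}x y /orP[]/eqP->; case: ifPn => xR //; auto; exact: connect0.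
case/orP => /eqP->.
  case: (boolP (d \in Ra)) => dR.
    apply: con_cut => //; [exact: smoothK|exact: edgeK|exact: smoothN|exact: edgeN| |].
      by move=> y dy yR; apply: uniqRa.
    by move=> y dy; apply: noRaRb dy.
  by apply: con1; rewrite /r0 /rel_of2 /= (negPf dR) eqxx.
case: (boolP (d \in Rb)) => dR.
  apply: con_rel_of2C; apply: con_cut => //;
    [exact: edgeK|exact: smoothK|exact: edgeN|exact: smoothN| |].
    by move=> y /con_rel_of2C dy yR; apply: uniqRb.
  move=> y /con_rel_of2C dy; apply/negP => yR.
  by have := noRaRb yR; move=> /(_ d); rewrite dR; rewrite con_sym => /(_ dy).
by apply: con1; rewrite /r0 /rel_of2 /= (negPf dR) eqxx orbT.
Qed.
End TrelCut.

(** * The parallel Reidemeister II move *)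

Section R2.
Variables (X M : finType) (s : {perm pt X M}) (sg : X -> bool) (l r : pt X M).
Hypothesis lr : l != r.

Definition R2_sgn (x : X + bool) : bool := match x with inl x => sg x | inr b => b end.
Local Notation s2 := (R2_perm s l r).
Local Notation old := (oldp bool).
Local Notation c1 ov := (inl (inr true, ov)).
Local Notation c2 ov := (inl (inr false, ov)).

Lemma R2_crel_edge w :
  con (crel s2 R2_sgn) (old w, false) (old (s w), true).
Proof.
have [sw [sl s1l s2l] [sr s1r s2r]] := R2_permE s lr.
have cE := con_crel_edge s2 R2_sgn.
case: (eqVneq w l) => [->|wl].
  apply: connect_trans (cE _) _; rewrite sl -s2l.
  apply: connect_trans _ (cE _); apply: (@connect_trans _ _ (c1 false, false)).
    exact: con_vertex.
  by apply: connect_trans (cE _) _; rewrite s1l; apply: con_vertex.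
case: (eqVneq w r) => [->|wr]; last by rewrite -sw //; apply: cE.
apply: connect_trans (cE _) _; rewrite sr -s2r.
apply: connect_trans _ (cE _); apply: (@connect_trans _ _ (c1 true, false)).
  exact: con_vertex.
by apply: connect_trans (cE _) _; rewrite s1r; apply: con_vertex.
Qed.

Lemma R2_crel_map d e : crel s sg d e -> con (crel s2 R2_sgn) (oldd bool d) (oldd bool e).
Proof.
apply: crel_map => [w|d']; first exact: R2_crel_edge.
by rewrite -(oldd_rot (sg' := R2_sgn)) //; apply: con_rot.
Qed.

Lemma R2_crel_cover y : exists d, con (crel s2 R2_sgn) y (oldd bool d).
Proof.
have [sw [sl s1l s2l] [sr s1r s2r]] := R2_permE s lr.
case: y => w d; case: (pt_extP w) => [q|y ov]; first by exists (q, d); apply: connect0.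
case: y; [exists (l, false)|exists (s l, true)]; rewrite con_sym.
  apply: connect_trans (con_crel_edge _ _ _) _.
  by rewrite sl; apply: con_vertex.
rewrite con_sym /oldd /= -s2l; apply: connect_trans _ (con_crel_edge _ _ _).
exact: con_vertex.
Qed.

Lemma R2_crel : ncomp (crel s2 R2_sgn) <= ncomp (crel s sg).
Proof.
have := ncomp_le_map (A := set0) R2_crel_map; rewrite cards0 addn0; apply => y.
by left; apply: R2_crel_cover.
Qed.

Lemma R2_crel_join : ~~ con (crel s sg) (l, false) (r, false) ->
  ncomp (crel s2 R2_sgn) < ncomp (crel s sg).
Proof.
have [sw [sl s1l s2l] [sr s1r s2r]] := R2_permE s lr => nlr.
have := ncomp_lt_map (A := set0) R2_crel_map _ nlr; rewrite cards0 addn0; apply => [y|].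
  by left; apply: R2_crel_cover.
apply: (connect_trans (con_crel_edge s2 R2_sgn (old l))).
rewrite con_sym; apply: (connect_trans (con_crel_edge s2 R2_sgn (old r))).
by rewrite sl sr; apply: con_vertex.
Qed.

(* Up to the new bigon, the face permutation becomes [tperm a b * ph]: the move
   splits the common face of the two strands, or merges their two faces if the
   strands belong to different components of the diagram. *)
Lemma R2_planar : planarb s sg ->
  con (next_rel (face_step s sg)) (l, false) (s r, true)
  \/ ~~ con (crel s sg) (l, false) (r, false) ->
  planarb s2 R2_sgn.
Proof.
have [sw [sl s1l s2l] [sr s1r s2r]] := R2_permE s lr.
move=> pl side; move: (pl); rewrite planarbE => /eqP F; apply: planarbI.
rewrite card_sum card_bool.
pose a : dart X M := (l, false); pose b : dart X M := (s r, true).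
pose ph := perm (@face_step_inj _ _ s sg).
pose ph0 := (tperm a b * ph)%g.
have phE d : ph d = face_step s sg d by rewrite permE.
have Fph : ncomp (next_rel (face_step s sg)) = #|porbits ph|.
  by rewrite -ncomp_perm; apply: ncomp_eq_map (id) (id) _ _ _ _ => *;
    rewrite ?connect0 //; apply: con1; rewrite /next_rel ?phE // -?phE.
have ab : a != b by rewrite /a /b xpair_eqE andbF.
pose f0 d := porbit ph0 d.
have f0E d e : ph0 d = e -> f0 e = f0 d.
  by move=> <-; rewrite /f0 -(porbit_perm ph0 1 d) expg1.
have e1 w : w != l -> f0 (rot sg (s w, true)) = f0 (w, false).
  move=> wl; apply: f0E; rewrite permM tpermD ?phE //.
    by apply: contra wl => /eqP[->].
  by rewrite /b xpair_eqE andbF.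
have e2 w : w != r -> f0 (rot sg (w, false)) = f0 (s w, true).
  move=> wr; apply: f0E; rewrite permM tpermD.
  - by rewrite phE /face_step /edge /= permK.
  - by rewrite /a xpair_eqE andbF.
  by apply: contra wr => /eqP[/perm_inj->].
have e3 : f0 (rot sg (s l, true)) = f0 (s r, true).
  by apply: f0E; rewrite permM tpermR phE.
have e4 : f0 (rot sg (r, false)) = f0 (l, false).
  by apply: f0E; rewrite permM tpermL phE /face_step /edge /= permK.
(* [None] is the bigon, to the right of the upper arc and to the left of the lower arc. *)
pose fn (y ov d : bool) : option {set dart X M} :=
  match y, ov, d with
  | true, true, true => Some (f0 (l, false))
  | false, false, false => Some (f0 (s r, true))
  | true, false, false => Some (f0 (r, false))
  | false, true, false => Some (f0 (r, false))
  | false, true, true => Some (f0 (s l, true))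
  | true, false, true => Some (f0 (s l, true))
  | true, true, false => None
  | false, false, true => None
  end.
pose f := ext_dart_fun (fun d => Some (f0 d)) fn.
have fo w d : f (old w, d) = Some (f0 (w, d)) by exact: ext_dart_fun_old.
have ro w d : f (rot R2_sgn (old w, d)) = Some (f0 (rot sg (w, d))).
  have := oldd_rot (sg' := R2_sgn) (sg := sg) (w, d); rewrite /oldd /= => -> //.
  by rewrite fo -surjective_pairing.
have F2 : #|porbits ph0|.+1 <= ncomp (next_rel (face_step s2 R2_sgn)).
  have -> : #|porbits ph0|.+1 = #|None |: [set Some x | x in porbits ph0]|.
    rewrite cardsU1 card_imset; last by move=> ? ? [].
    by rewrite (_ : None \notin _) //; apply/imsetP => -[].
  apply: (ncomp_ge_const (f := f)) => [|x]; last first.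
    rewrite !inE => /orP[/eqP->|/imsetP[_ /imsetP[d _ ->] ->]].
      by exists (c1 true, false).
    by exists (oldd bool d); rewrite /oldd fo -surjective_pairing.
  apply: next_face_const => w; case: (pt_extP w) => [q|[] []].
  - case: (eqVneq q l) => [->|ql]; first by rewrite sl fo.
    case: (eqVneq q r) => [->|qr]; first by rewrite sr fo.
    by rewrite sw // ro e1 ?fo.
  - by rewrite s1r.
  - by rewrite s1l.
  - by rewrite s2r ro e1 // eq_sym.
  - by rewrite s2l ro e3.
  - case: (eqVneq q l) => [->|ql]; first by rewrite sl ro e2.
    case: (eqVneq q r) => [->|qr]; first by rewrite sr ro e4.
    by rewrite sw // ro e2 ?fo.
  - by rewrite s1r.
  - by rewrite s1l.
  - by rewrite s2r fo.
  - by rewrite s2l fo.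
suff : #|X| + 2 + 2 * ncomp (crel s2 R2_sgn) <= #|porbits ph0|.+1 by move/leq_trans; apply.
have {}F : ncomp (next_rel (face_step s sg)) = #|X| + 2 * ncomp (crel s sg) by [].
have /= := porbits_mul_tperm ph a b; rewrite -/ph0 ab -Fph F.
(* Two new crossings require two more faces: the bigon and the second half of the split face. For
   different components at most one old face is lost, while the number of components, which counts
   twice, drops. *)
case: side => [fab|/R2_crel_join C2].
  have -> : a \notin porbit ph b = false.
    apply/negbF; rewrite porbit_sym -con_next_porbit.
    apply: (con_map (h := id)) fab => x y /eqP->; by apply: con1; rewrite /next_rel phE.
  by move=> H; rewrite -muln2 /= mul0n in H; have := R2_crel; lia.
by case: (_ \notin _) => H; rewrite -muln2 /= ?mul1n in H; lia.
Qed.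

(* The half-edges of the small circle formed by the two arcs of the bigon. *)
Definition R2_inner (d : dart (X + bool) M) : bool :=
  ext_dart_fun (fun=> false) (fun y _ b => y != b) d.

Lemma R2_trel_inner d e : con (trel s2) d e -> R2_inner d = R2_inner e.
Proof.
have [sw [sl s1l s2l] [sr s1r s2r]] := R2_permE s lr.
apply: trel_const => [w|d']; last exact: ext_dart_fun_smooth.
case: (pt_extP w) => [q|[] []]; rewrite /R2_inner ?s1r ?s1l ?s2r ?s2l ?ext_dart_fun_old //.
case: (eqVneq q l) => [->|ql]; first by rewrite sl.
case: (eqVneq q r) => [->|qr]; first by rewrite sr.
by rewrite sw ?ext_dart_fun_old.
Qed.

Lemma R2_trel_inner_all d e : R2_inner d -> R2_inner e -> con (trel s2) d e.
Proof.
have [sw [sl s1l s2l] [sr s1r s2r]] := R2_permE s lr.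
have E := con_trel_edge s2.
have S y x d0 : con (trel s2) (inl (inr y, x), d0) (inl (inr y, ~~ x), d0).
  exact: (con_trel_smooth s2 (inl (inr y, x), d0)).
suff H f : R2_inner f -> con (trel s2) f (c1 true, false).
  by move=> /H df /H; rewrite con_sym; apply: connect_trans df.
case: f => w b; case: (pt_extP w) => [q|[] []]; rewrite /R2_inner ?ext_dart_fun_old //=;
  case: b => // _.
- by rewrite con_sym -s1r; apply: E.
- by apply: connect_trans (S false false true) _; rewrite con_sym -s1r; apply: E.
Qed.

(** Giving the circle of [w] the label of the circle of the other strand [w'] yields an invariant of
    the move, [rho], which still separates all circles other than that of [w]. *)
Lemma R2_trel_merge (z : bool) d e :
  let w := if z then r else l in
  ~~ con (trel s) d e -> ~~ con (trel s) d (w, false) -> ~~ con (trel s) e (w, false) ->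
  ~~ con (trel s2) (oldd bool d) (oldd bool e).
Proof.
have [sw [sl s1l s2l] [sr s1r s2r]] := R2_permE s lr.
move=> w nde ndw new; pose w' := if z then l else r.
pose rt := root (sym_rel (trel s)).
pose rho d := if con (trel s) d (w, false) then rt (w', false) else rt d.
pose f := ext_dart_fun rho (fun _ _ _ : bool => rt (w', false)).
apply/negP => de; suff : f (oldd bool d) = f (oldd bool e).
  by rewrite /f !ext_dart_fun_oldd /rho (negPf ndw) (negPf new) => /eqP; rewrite -trel_root (negPf nde).
have rhoE x y : con (trel s) x y -> rho x = rho y.
  move=> xy; rewrite /rho; have -> : con (trel s) x (w, false) = con (trel s) y (w, false).
    by apply: same_connect xy _ => //; apply: con_sym.
  by case: ifP => // _; apply/eqP; rewrite -trel_root.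
have rhol : rho (l, false) = rt (w', false).
  by rewrite /rho /w /w'; case: (z); rewrite ?connect0 //; case: ifP.
have rhor : rho (r, false) = rt (w', false).
  by rewrite /rho /w /w'; case: (z); rewrite ?connect0 //; case: ifP.
have rhoe q : rho (s q, true) = rho (q, false).
  by apply: rhoE; rewrite con_sym; apply: con_trel_edge.
apply: trel_const de => [q|d']; last first.
  by apply: ext_dart_fun_smooth => // x; apply: rhoE; rewrite con_sym; apply: con_trel_smooth.
case: (pt_extP q) => [{}q|[] []]; rewrite /f ?s1r ?s1l ?s2r ?s2l ?ext_dart_fun_old ?rhoe //.
case: (eqVneq q l) => [->|ql]; first by rewrite sl rhol.
case: (eqVneq q r) => [->|qr]; first by rewrite sr rhor.
by rewrite sw ?ext_dart_fun_old ?rhoe.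
Qed.

Lemma R2_ntau : ~~ con (trel s) (l, false) (r, false) ->
  ncomp (trel s2) <= ncomp (trel s).
Proof.
have [sw [sl s1l s2l] [sr s1r s2r]] := R2_permE s lr => nlr.
have E := con_trel_edge s2.
have S y x d0 : con (trel s2) (inl (inr y, x), d0) (inl (inr y, ~~ x), d0).
  exact: (con_trel_smooth s2 (inl (inr y, x), d0)).
(* The strands lie on different circles, so each of these is cut at one edge only. *)
pose Rb := [set d : dart X M | (d == (l, false)) || (d == (s l, true))
                            || (d == (r, false)) || (d == (s r, true))].
have hmap d e : trel s d e -> con (trel s2) (oldd bool d) (oldd bool e).
  apply: (trel_cut_map (Ra := set0) (Rb := Rb)) => {d e}.
  - by move=> d e; rewrite inE.
  - have lE : con (trel s) (l, false) (s l, true) by apply: con_trel_edge.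
    have rE : con (trel s) (r, false) (s r, true) by apply: con_trel_edge.
    have n x y : x \in [:: (l, false); (s l, true)] -> y \in [:: (r, false); (s r, true)] ->
      con (trel s) x y = false.
      rewrite !inE => xl yr; apply/negP => xy; case/negP: nlr.
      have lx : con (trel s) (l, false) x by case/orP: xl => /eqP->.
      have ry : con (trel s) (r, false) y by case/orP: yr => /eqP->.
      by apply: connect_trans lx _; apply: connect_trans xy _; rewrite con_sym.
    move=> d e; rewrite !inE -!orbA => /or4P[]/eqP-> de /or4P[]/eqP ee; move: de;
      rewrite {}ee;
      rewrite /edge /= ?permK;
      solve [ by move=> _; left | by move=> _; right
            | by rewrite n ?inE ?eqxx ?orbT | by rewrite con_sym n ?inE ?eqxx ?orbT ].
  - by move=> d e; rewrite inE.
  - by move=> d _; rewrite -oldd_smooth; apply: con_trel_smooth.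
  - have G w : w != l -> w != r -> con (trel s2) (oldd bool (w, false)) (oldd bool (s w, true)).
      by move=> wl wr; rewrite /oldd /= -sw //; apply: E.
    case=> w b; rewrite inE !negb_or -!andbA => /and4P[n1 n2 n3 n4].
    case: b n1 n2 n3 n4 => n1 n2 n3 n4; rewrite /edge /=.
      rewrite -{1}(permKV s w) con_sym; apply: G.
        by apply: contra n2 => /eqP<-; rewrite permKV.
      by apply: contra n4 => /eqP<-; rewrite permKV.
    by apply: G; [apply: contra n1|apply: contra n3] => /eqP->.
(* The small circle, represented by one of its half-edges, adds one class, and the merge of the
   circles of [l] and [r] removes one. *)
rewrite -ltnS -[in X in _ < X]addn1 -(cards1 ((c1 true, false) : dart (X + bool) M)).
apply: (ncomp_lt_map hmap) nlr _ => [y|].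
  case: (boolP (R2_inner y)) => iy; [right|left].
    by exists (c1 true, false); rewrite ?inE // R2_trel_inner_all.
  case: y iy => w b; case: (pt_extP w) => [q|[] []]; rewrite /R2_inner ?ext_dart_fun_old //=;
    case: b => // _.
  - by exists (q, true); apply: connect0.
  - by exists (q, false); apply: connect0.
  - by exists (r, false); rewrite con_sym /oldd /= -sr; apply: E.
  - by exists (l, false); rewrite con_sym /oldd /= -sl; apply: E.
  - by exists (s r, true); rewrite /oldd /= -s2r; apply: E.
  - by exists (s l, true); rewrite /oldd /= -s2l; apply: E.
apply: connect_trans (E _) _; rewrite sl; apply: connect_trans (S _ _ _) _.
by rewrite con_sym; apply: connect_trans (E _) _; rewrite sr connect0.
Qed.

Lemma R2_edge (d : dart X M) :
  (if d.2 then d.1 \notin [:: s l; s r] else d.1 \notin [:: l; r]) ->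
  edge s2 (oldd bool d) = oldd bool (edge s d).
Proof.
have [sw [sl s1l s2l] [sr s1r s2r]] := R2_permE s lr.
case: d => w [] /=; rewrite !inE negb_or => /andP[n1 n2]; last first.
  by rewrite /edge /oldd /= sw.
congr (_, _); apply: (@perm_inj _ s2); rewrite permKV sw ?permKV //.
  by apply: contra n1 => /eqP<-; rewrite permKV.
by apply: contra n2 => /eqP<-; rewrite permKV.
Qed.

Lemma R2_face_step d :
  (if d.2 then d.1 \notin [:: s l; s r] else d.1 \notin [:: l; r]) ->
  face_step s2 R2_sgn (oldd bool d) = oldd bool (face_step s sg d).
Proof. by move=> H; rewrite /face_step R2_edge // (oldd_rot (sg := sg)). Qed.

(** From the outer sides of the two strands, the right of [r] and the left of [l], the small circle
    is one step away. This is how a finger reaches the next face. *)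
Lemma R2_face_step_tip :
  R2_inner (face_step s2 R2_sgn (oldd bool (r, false)))
  /\ R2_inner (face_step s2 R2_sgn (oldd bool (s l, true))).
Proof.
have [sw [sl s1l s2l] [sr s1r s2r]] := R2_permE s lr.
by rewrite /face_step /edge /oldd /= sr -s2l permK.
Qed.
End R2.

Lemma R1_equiv (X M : finType) (s : {perm pt X M}) sg p b
    (pl : planarb s sg) (pl1 : planarb (R1_perm s p) (R1_sgn sg b)) :
  link_equiv (Diagram pl) (Diagram pl1).
Proof.
have [s1w s1p s1t s1f] := R1_permE s p.
apply: le_step; apply: Or43; exists inl, id, (inr tt), p, true; split=> //.
split=> // [? ? []//|[x|[]]|]; [by right; exists x|by left|by exists id].
Qed.

Lemma R2_equiv (X M : finType) (s : {perm pt X M}) sg l r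
    (pl : planarb s sg) (pl2 : planarb (R2_perm s l r) (R2_sgn sg)) :
  l != r -> link_equiv (Diagram pl) (Diagram pl2).
Proof.
move=> lr; have [sw [sl s1l s2l] [sr s1r s2r]] := R2_permE s lr.
apply: le_step; apply: Or44; left.
exists inl, id, (inr true), (inr false), l, r, false, true; split; last first.
  by split=> //; split; split.
split=> // [? ? []//|[x|[]]|]; [|by apply: Or31|by apply: Or32|by exists id].
by apply: Or33; exists x.
Qed.

(** * A Reidemeister III move *)

(* The three strands are parallel: [t1 -> t3] is the top strand, and the two
   strands of [x] go on under it, [v -> f1] and [u -> f3]. *)
Section R3.
Variables (X M : finType) (s : {perm pt X M}) (sg : X -> bool) (c1 c3 x : X).
Hypothesis c1c3x : [&& c1 != c3, c1 != x & c3 != x].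
Hypotheses (sg1 : sg c1 = true) (sg3 : sg c3 = true).
Local Notation P := (pt X M).
Definition R3_t1 : P := inl (c1, true).
Definition R3_t3 : P := inl (c3, true).
Definition R3_f1 : P := inl (c1, false).
Definition R3_f3 : P := inl (c3, false).
(** For either sign of [x], [v] is the strand that enters on the left and leaves on the right, and
    [u] the one that enters on the right and leaves on the left. *)
Definition R3_v : P := inl (x, ~~ sg x).
Definition R3_u : P := inl (x, sg x).
Local Notation t1 := R3_t1.
Local Notation t3 := R3_t3.
Local Notation f1 := R3_f1.
Local Notation f3 := R3_f3.
Local Notation v := R3_v.
Local Notation u := R3_u.
Definition R3_six : seq P := [:: t1; t3; f1; f3; v; u].
Local Notation six := R3_six.
Hypotheses (st1 : s t1 = t3) (sv : s v = f1) (su : s u = f3).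
Hypotheses (st3 : s t3 \notin six) (sf1 : s f1 \notin six) (sf3 : s f3 \notin six).

Definition R3_swap : {perm P} := (tperm t1 t3 * (tperm v f1 * tperm u f3))%g.
Local Notation sw := R3_swap.
Definition R3_perm : {perm P} := (sw * s * sw)%g.
Local Notation s3 := R3_perm.

Lemma R3_six_uniq : uniq six.
Proof.
rewrite /= !inE /t1 /t3 /f1 /f3 /v /u.
have E a b (y z : X) : ((inl (y, a) : P) == inl (z, b)) = (y == z) && (a == b) by [].
case/and3P: c1c3x => /negPf n1 /negPf n2 /negPf n3.
rewrite !E n1 n2 n3 /= !andbF !eqxx /= !andbT.
by case: (sg x).
Qed.

Lemma R3_neqs :
  (((t1 == t3) = false) * ((t1 == f1) = false) * ((t1 == f3) = false) *
   ((t1 == v) = false) * ((t1 == u) = false) * ((t3 == t1) = false) *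
   ((t3 == f1) = false) * ((t3 == f3) = false) * ((t3 == v) = false) *
   ((t3 == u) = false) * ((f1 == t1) = false) * ((f1 == t3) = false) *
   ((f1 == f3) = false) * ((f1 == v) = false) * ((f1 == u) = false) *
   ((f3 == t1) = false) * ((f3 == t3) = false) * ((f3 == f1) = false) *
   ((f3 == v) = false) * ((f3 == u) = false) * ((v == t1) = false) *
   ((v == t3) = false) * ((v == f1) = false) * ((v == f3) = false) *
   ((v == u) = false) * ((u == t1) = false) * ((u == t3) = false) *
   ((u == f1) = false) * ((u == f3) = false) * ((u == v) = false))%type.
Proof.
have N i j : i < 6 -> j < 6 -> (nth t1 six i == nth t1 six j) = (i == j).
  by move=> i6 j6; rewrite nth_uniq // R3_six_uniq.
exact: (N 0 1 isT isT, N 0 2 isT isT, N 0 3 isT isT, N 0 4 isT isT, N 0 5 isT isT,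
  N 1 0 isT isT, N 1 2 isT isT, N 1 3 isT isT, N 1 4 isT isT, N 1 5 isT isT,
  N 2 0 isT isT, N 2 1 isT isT, N 2 3 isT isT, N 2 4 isT isT, N 2 5 isT isT,
  N 3 0 isT isT, N 3 1 isT isT, N 3 2 isT isT, N 3 4 isT isT, N 3 5 isT isT,
  N 4 0 isT isT, N 4 1 isT isT, N 4 2 isT isT, N 4 3 isT isT, N 4 5 isT isT,
  N 5 0 isT isT, N 5 1 isT isT, N 5 2 isT isT, N 5 3 isT isT, N 5 4 isT isT).
Qed.

Lemma R3_notin w : w \notin six ->
  ((w == t1) = false) * ((w == t3) = false) * ((w == f1) = false) *
  ((w == f3) = false) * ((w == v) = false) * ((w == u) = false).
Proof.
by rewrite !in_cons in_nil !negb_or => /and5P[] /negPf-> /negPf-> /negPf-> /negPf-> /and3P[] /negPf-> /negPf->.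
Qed.

Lemma R3_sixP w : w \in six ->
  [\/ w = t1, w = t3 | w = f1] \/ [\/ w = f3, w = v | w = u].
Proof.
rewrite /R3_six !in_cons in_nil orbF.
case/orP=> [|/orP[|/orP[|/orP[|/orP[]]]]] /eqP->;
  by [left; constructor | right; constructor].
Qed.

Lemma R3_in_six :
  (t1 \in six) * (t3 \in six) * (f1 \in six) * (f3 \in six) * (v \in six) * (u \in six).
Proof. by rewrite /R3_six !in_cons !eqxx ?orbT. Qed.

Lemma R3_six_vertex w : (w \in six) = (vertex w \in [:: inl c1; inl c3; inl x]).
Proof.
apply/idP/idP => [/R3_sixP H|].
  by case: H => [] [] ->; rewrite !in_cons ?eqxx ?orbT.
have [[[[[m1 m2] m3] m4] m5] m6] := R3_in_six.
rewrite !in_cons in_nil orbF => /or3P[] /eqP; case: w => [[y ov]|m] //= [->].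
- by case: ov.
- by case: ov.
by have [->|/bool_neq->] := eqVneq ov (sg x).
Qed.

Lemma R3_swapE :
  [/\ sw t1 = t3, sw t3 = t1, sw f1 = v & sw f3 = u] /\
  [/\ sw v = f1, sw u = f3 & forall w, w \notin six -> sw w = w].
Proof.
have tE (a b y : P) : tperm a b y = if y == a then b else if y == b then a else y by rewrite permE.
split; split; rewrite /sw ?permM; try (by rewrite !(tE, R3_neqs, eqxx)).
by move=> w nw; rewrite !permM !(tE, R3_notin nw).
Qed.

Lemma R3_swap_six w : (sw w \in six) = (w \in six).
Proof.
have [[e1 e2 e3 e4] [e5 e6 e7]] := R3_swapE.
case: (boolP (w \in six)) => [|nw]; last by rewrite e7 // (negPf nw).
by case/R3_sixP=> -[] ->;
  rewrite ?e1 ?e2 ?e3 ?e4 ?e5 ?e6 !R3_in_six.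
Qed.

Lemma R3_swapK w : sw (sw w) = w.
Proof.
have [[e1 e2 e3 e4] [e5 e6 e7]] := R3_swapE.
case: (boolP (w \in six)) => [|nw]; last by rewrite !e7 // e7.
by case/R3_sixP=> -[] ->;
  rewrite ?e1 ?e2 ?e3 ?e4 ?e5 ?e6.
Qed.

Lemma R3_permK w : s3 (sw w) = sw (s w).
Proof.
have -> : s3 (sw w) = sw (s (sw (sw w))) by rewrite /R3_perm permM permM.
by rewrite R3_swapK.
Qed.

Lemma R3_permE :
  [/\ s3 t3 = t1, s3 t1 = s t3, s3 f1 = v & s3 v = s f1] /\
  [/\ s3 f3 = u, s3 u = s f3 &
   forall w, w \notin six -> s3 w = sw (s w)].
Proof.
have [[e1 e2 e3 e4] [e5 e6 e7]] := R3_swapE.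
do !split; rewrite -1?R3_permK.
- by rewrite -e1 R3_permK st1.
- by rewrite -e2 R3_permK e7.
- by rewrite -e5 R3_permK sv.
- by rewrite -e3 R3_permK e7.
- by rewrite -e6 R3_permK su.
- by rewrite -e4 R3_permK e7.
- by move=> w nw; rewrite -{1}(e7 w nw) R3_permK.
Qed.

Lemma R3_rot :
  [/\ rot sg (t1, true) = (f1, false), rot sg (f1, false) = (t1, false),
      rot sg (t1, false) = (f1, true) & rot sg (f1, true) = (t1, true)] /\
  [/\ rot sg (t3, true) = (f3, false), rot sg (f3, false) = (t3, false),
      rot sg (t3, false) = (f3, true) & rot sg (f3, true) = (t3, true)] /\
  [/\ rot sg (u, true) = (v, false), rot sg (v, false) = (u, false),
      rot sg (u, false) = (v, true) & rot sg (v, true) = (u, true)].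
Proof.
by rewrite /rot /= sg1 sg3 /u /v; do !split; case: (sg x).
Qed.

Lemma R3_con_six d e : d.1 \in six -> e.1 \in six -> con (crel s3 sg) d e.
Proof.
have [[r1 r2 r3 r4] [r5 r6 r7]] := R3_permE.
suff H d' : d'.1 \in six -> con (crel s3 sg) d' (t1, true).
  by move=> /H d1 /H; rewrite con_sym; apply: connect_trans d1.
have H1 d0 : vertex d0.1 = inl c1 -> con (crel s3 sg) d0 (t1, true).
  by move=> V; apply: con_vertex; rewrite V.
have H3 d0 : vertex d0.1 = inl c3 -> con (crel s3 sg) d0 (t1, true).
  move=> V; apply: connect_trans (_ : con _ _ (t3, false)) _; first by apply: con_vertex; rewrite V.
  by rewrite -r1; apply: con_crel_edge.
have Hx d0 : vertex d0.1 = inl x -> con (crel s3 sg) d0 (t1, true).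
  move=> V; apply: connect_trans (_ : con _ _ (v, true)) _; first by apply: con_vertex; rewrite V.
  rewrite -r3 con_sym; apply: connect_trans _ (con_crel_edge _ _ _); rewrite con_sym.
  exact: H1.
by case: d' => w b /= /R3_sixP[] [] ->; auto.
Qed.

Lemma R3_con_swap w b : con (crel s3 sg) (w, b) (sw w, b).
Proof.
have [_ [_ _ e7]] := R3_swapE.
case: (boolP (w \in six)) => [w6|/e7->]; last exact: connect0.
by apply: R3_con_six; rewrite //= R3_swap_six.
Qed.

Lemma R3_crel : ncomp (crel s3 sg) <= ncomp (crel s sg).
Proof.
have := @ncomp_le_map _ _ (crel s sg) (crel s3 sg) id set0.
rewrite cards0 addn0; apply; last by move=> y; left; exists y; apply: connect0.
apply: crel_map => [w|d]; last exact: con_rot.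
apply: connect_trans (R3_con_swap _ _) _.
apply: connect_trans (con_crel_edge _ _ _) _; rewrite R3_permK con_sym.
exact: R3_con_swap.
Qed.

Lemma R3_planar : planarb s sg -> planarb s3 sg.
Proof.
have [[r1 r2 r3 r4] [r5 r6 r7]] := R3_permE.
have [[p1 p2 p3 p4] [[q1 q2 q3 q4] [x1 x2 x3 x4]]] := R3_rot.
have [[e1 e2 e3 e4] [e5 e6 e7]] := R3_swapE.
rewrite planarbE => /eqP F; apply: planarbI.
suff F3 : ncomp (next_rel (face_step s sg)) <= ncomp (next_rel (face_step s3 sg)).
  by have := R3_crel; move: F3; rewrite F; lia.
pose fr := face_root s sg.
have fout w : fr (rot sg (s w, true)) = fr (w, false) by exact: face_root_phi s sg (w, false).
have fin w : fr (rot sg (w, false)) = fr (s w, true).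
  by have := face_root_phi s sg (s w, true); rewrite /face_step /edge /= permK.
(* [f] sends a half-edge after the move to a half-edge of the corresponding face
   before the move; the triangle goes to the triangle. *)
pose f (d : dart X M) :=
  if d.1 == t1 then if d.2 then fr (u, true) else fr (t3, false)
  else if d.1 == t3 then if d.2 then fr (v, false) else fr (t3, true)
  else if d.1 == f1 then if d.2 then fr (f3, true) else fr (t3, true)
  else if d.1 == f3 then if d.2 then fr (u, true) else fr (f1, false)
  else if d.1 == v then if d.2 then fr (t3, false) else fr (f1, false)
  else if d.1 == u then if d.2 then fr (t3, true) else fr (t1, false)
  else fr d.
have ft1 b : f (t1, b) = if b then fr (u, true) else fr (t3, false) by rewrite /f /= !(R3_neqs, eqxx).
have ft3 b : f (t3, b) = if b then fr (v, false) else fr (t3, true) by rewrite /f /= !(R3_neqs, eqxx).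
have ff1 b : f (f1, b) = if b then fr (f3, true) else fr (t3, true) by rewrite /f /= !(R3_neqs, eqxx).
have ff3 b : f (f3, b) = if b then fr (u, true) else fr (f1, false) by rewrite /f /= !(R3_neqs, eqxx).
have fv b : f (v, b) = if b then fr (t3, false) else fr (f1, false) by rewrite /f /= !(R3_neqs, eqxx).
have fu b : f (u, b) = if b then fr (t3, true) else fr (t1, false) by rewrite /f /= !(R3_neqs, eqxx).
have fo w b : w \notin six -> f (w, b) = fr (w, b).
  by move=> nw; rewrite /f /= !(R3_notin nw).
have ro w b : w \notin six -> f (rot sg (w, b)) = fr (rot sg (w, b)).
  move=> nw; rewrite [rot sg _]surjective_pairing fo //.
  by rewrite R3_six_vertex vertex_rot -R3_six_vertex.
have E1 : fr (t1, false) = fr (f3, false) by rewrite -(fout t1) st1 q1.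
have E2 : fr (f3, true) = fr (v, true) by rewrite -su -fin x3.
have E3 : fr (v, false) = fr (t1, true) by rewrite -fout sv p4.
have E4 : fr (f1, true) = fr (t3, true).
  by rewrite -p3 -[t3]st1 -fin.
have E5 : fr (u, false) = fr (t3, true) by rewrite -fout su q4.
(* The triangle is entered only at the first passage of each of its three strands. *)
have ps w : s w \in six -> w \notin six ->
    [\/ s w = t1, s w = v | s w = u].
  have K a : w \notin six -> a \in six -> s w = s a -> False.
    by move=> nw a6 /perm_inj wa; rewrite wa a6 in nw.
  move=> /R3_sixP[] [] sw6 nw; try by [apply: Or31|apply: Or32|apply: Or33].
  - by case: (K t1 nw); rewrite ?R3_in_six // st1.
  - by case: (K v nw); rewrite ?R3_in_six // sv.
  - by case: (K u nw); rewrite ?R3_in_six // su.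
apply: leq_trans (_ : #|[set d | fr d == d]| <= _).
  by rewrite ncompE cardsE; apply: subset_leq_card; apply/subsetP.
apply: (ncomp_ge_const (f := f)) => [|d]; last first.
  rewrite inE => /eqP rd; case: (boolP (d.1 \in six)) => [d6|nd]; last first.
    by exists d; rewrite [d]surjective_pairing fo // -surjective_pairing.
  rewrite -rd; case: d d6 {rd} => w b /= /R3_sixP[] [] ->; case: b.
  - by exists (t3, true); rewrite ft3.
  - by exists (u, false); rewrite fu.
  - by exists (t3, false); rewrite ft3.
  - by exists (t1, false); rewrite ft1.
  - by exists (t3, false); rewrite ft3.
  - by exists (v, false); rewrite fv.
  - by exists (f1, true); rewrite ff1.
  - by exists (u, false); rewrite fu.
  - by exists (f1, true); rewrite ff1.
  - by exists (t3, true); rewrite ft3.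
  - by exists (t1, true); rewrite ft1.
  - by exists (t3, false); rewrite ft3.
apply: next_face_const => w; case: (boolP (w \in six)).
- case/R3_sixP => -[] ->.
  + by rewrite r2 ro // fout ft1.
  + by rewrite r1 p1 ff1 ft3.
  + by rewrite r3 x4 fu ff1.
  + by rewrite r5 x1 fv ff3.
  + by rewrite r4 ro // fout fv.
  + by rewrite r6 ro // fout fu E1.
- move=> nw; rewrite r7 // fo //; case: (boolP (s w \in six)) => [s6|ns]; last first.
    by rewrite e7 // ro // fout.
  case: (ps _ s6 nw) => sE; rewrite -(fout w) sE ?e1 ?e5 ?e6.
  + by rewrite q1 ff3 p1.
  + by rewrite p4 ft1 x4.
  + by rewrite q4 ft3 x1.
- case/R3_sixP => -[] ->.
  + by rewrite r2 p3 ff1 fo // -fin q3.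
  + by rewrite r1 q3 ff3 ft1.
  + by rewrite r3 p2 ft1 fv.
  + by rewrite r5 q2 ft3 fu.
  + by rewrite r4 x2 fu fo // -fin p2.
  + by rewrite r6 x3 fv fo // -fin q2.
- move=> nw; rewrite r7 // ro // fin; case: (boolP (s w \in six)) => [s6|ns]; last first.
    by rewrite e7 // fo.
  case: (ps _ s6 nw) => sE; rewrite sE ?e1 ?e5 ?e6.
  + by rewrite ft3 -E3.
  + by rewrite ff1 -E2.
  + by rewrite ff3.
Qed.

Lemma R3_swap2E r :
  sw r = swap2 t3 t1 (swap2 f3 u (swap2 f1 v r)) /\
  sw r = swap2 t1 t3 (swap2 f1 v (swap2 f3 u r)).
Proof.
have [[e1 e2 e3 e4] [e5 e6 e7]] := R3_swapE.
case: (boolP (r \in six)) => [/R3_sixP[] [] ->|nr].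
all: rewrite ?e1 ?e2 ?e3 ?e4 ?e5 ?e6 ?e7 // /swap2.
7: by rewrite !(R3_notin nr).
all: by rewrite !(R3_neqs, eqxx).
Qed.

Lemma R3_equiv (pl : planarb s sg) (pl3 : planarb s3 sg) :
  link_equiv (Diagram pl) (Diagram pl3).
Proof.
apply: le_step; apply: Or44; right.
have lid r : liftp (X' := X) (M' := M) id id r = r by case: r => [[]|].
have s3E r : s3 r = sw (s (sw r)) by rewrite /R3_perm !permM.
have idb (T : Type) : bijective (@id T) by exists id.
have /and3P[n1 n2 n3] := c1c3x.
have [uE vE] : u = inl (x, sg x) /\ v = inl (x, ~~ sg x) by [].
(* The middle strand is the one that passes over at [x]: it is [u] for positive [x] and [v] for
   negative [x]. The roles of [c1] and [c3] are exchanged accordingly. *)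
move: su sv; case E : (sg x) uE vE => /= uE vE suE svE.
  exists id, id, c3, c1, x, false, false, false; split; split=> //=.
  - by rewrite eq_sym n1 n2 n3.
  - by rewrite -/t1 st1.
  - by rewrite -uE suE.
  - by rewrite -vE svE.
  - by rewrite sg1 sg3 E.
  by move=> r; rewrite !lid -uE -vE s3E; have [-> _] := R3_swap2E (s (sw r)); have [-> _] := R3_swap2E r.
exists id, id, c1, c3, x, true, false, false; split; split=> //=.
- by rewrite n1 n2 n3.
- by rewrite -/t1 st1.
- by rewrite -vE svE.
- by rewrite -uE suE.
- by rewrite sg1 sg3 E.
by move=> r; rewrite !lid -uE -vE s3E; have [_ ->] := R3_swap2E (s (sw r)); have [_ ->] := R3_swap2E r.
Qed.
End R3.

(** * Merging three circles at a crossing *)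

(* As braids, the strands of [x] followed on their right by the strand of [p]
   form [sigma_1]; two Reidemeister II moves and one Reidemeister III move turn
   it into [sigma_2 sigma_1 sigma_2 sigma_1^-1 sigma_2^-1], and the incoherent
   smoothing [e_1] into [e_2 e_1 e_2 e_1 e_2 = e_2]. *)
Section TripleMove.
Variables (X M : finType) (s : {perm pt X M}) (sg : X -> bool).
Hypothesis pl : planarb s sg.
Variables (x : X) (p : pt X M).
Local Notation u := (inl (x, sg x) : pt X M).
Local Notation v := (inl (x, ~~ sg x) : pt X M).
Hypothesis nu : ~~ con (trel s) (u, true) (u, false).
Hypotheses (npi : ~~ con (trel s) (u, true) (p, false))
           (npo : ~~ con (trel s) (u, false) (p, false)).
Hypothesis face : con (next_rel (face_step s sg)) (v, false) (s p, true).

Let s1 := R2_perm s v p.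
Let sg1 := R2_sgn sg.
Let l2 : pt (X + bool) M := oldp bool u.
Let r2 : pt (X + bool) M := inl (inr true, true).
Let s2 := R2_perm s1 l2 r2.
Let sg2 := R2_sgn sg1.
Local Notation PP := (pt ((X + bool) + bool) M).
Let s3 : {perm PP} := R3_perm s2 sg2 (inl (inr true)) (inr true) (inl (inl x)).
Local Notation oo w := (oldp bool (oldp bool w)).
Local Notation C1 b := (inl (inl (inr true), b) : PP).
Local Notation C2 b := (inl (inl (inr false), b) : PP).
Local Notation C3 b := (inl (inr true, b) : PP).
Local Notation C4 b := (inl (inr false, b) : PP).

Lemma triple_uv b : con (trel s) (u, b) (v, b).
Proof. exact: (con_trel_smooth s (u, b)). Qed.

Lemma triple_far w b : w \in [:: u; v] ->
  ~~ con (trel s) (w, b) (p, false).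
Proof.
by rewrite !inE => /orP[]/eqP->; case: b; rewrite // ?(negPf npi) ?(negPf npo) //;
  apply/negP => vp; move: npi npo;
  rewrite ?(connect_trans (triple_uv _) vp).
Qed.

Lemma triple_in_out w w' : w \in [:: u; v] -> w' \in [:: u; v] ->
  ~~ con (trel s) (w, true) (w', false).
Proof.
have G a b : a \in [:: u; v] -> con (trel s) (u, b) (a, b).
  by rewrite !inE => /orP[]/eqP->; [apply: connect0|apply: triple_uv].
move=> wx wx'; apply: contra nu => ww'; apply: (connect_trans (G _ _ wx)).
by apply: (connect_trans ww'); rewrite con_sym; apply: G.
Qed.

(** An edge from [x] back to [x] would identify the incoming circle with the outgoing one.
    Distinctness of the three circles thus excludes the degenerate positions of the tangle. *)
Lemma triple_succ w : w \in [:: u; v] -> s w \notin [:: u; v].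
Proof.
move=> wx; apply/negP => sx; have /negP[] := triple_in_out sx wx.
by rewrite con_sym; apply: con_trel_edge.
Qed.

Lemma triple_p : p \notin [:: u; v] /\ s p \notin [:: u; v].
Proof.
split; apply/negP => px; first by have := triple_far false px; rewrite connect0.
by have := triple_far true px; rewrite con_sym con_trel_edge.
Qed.

Lemma triple_lr1 : v != p.
Proof. by have [] := triple_p; rewrite !inE negb_or eq_sym => /andP[_]; rewrite eq_sym. Qed.

Lemma triple_pl1 : planarb s1 sg1.
Proof. by apply: R2_planar => //; [exact: triple_lr1|left]. Qed.

Lemma triple_lr2 : l2 != r2.
Proof. by []. Qed.

Lemma triple_pl2 : planarb s2 sg2.
Proof.
apply: R2_planar => //; first exact: triple_pl1; left.
have [sw [sl s1l s2l] [sr s1r s2r]] := R2_permE s triple_lr1.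
have st d e : face_step s1 sg1 d = e -> con (next_rel (face_step s1 sg1)) e d.
  by move=> <-; apply: con1r; apply: eqxx.
(* The common face is the one between the outgoing strands of [x], followed around the new crossing
   [inr true]. *)
apply: (@connect_trans _ _ (inl (inr true, false), true)).
  apply: st; rewrite /face_step /edge /= -[inl (inr true, false)]sl permK.
  by rewrite /rot /l2 /=; case: (sg x).
by apply: st; rewrite /face_step /edge /= permK.
Qed.

Lemma triple_s1E :
  [/\ forall w, w != v -> w != p -> s1 (oldp _ w) = oldp _ (s w),
   [/\ s1 (oldp _ v) = inl (inr true, false),
      s1 (inl (inr true, false)) = inl (inr false, false) &
      s1 (inl (inr false, false)) = oldp _ (s v)] &
   [/\ s1 (oldp _ p) = inl (inr true, true),
      s1 (inl (inr true, true)) = inl (inr false, true) &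
      s1 (inl (inr false, true)) = oldp _ (s p)]].
Proof. exact: (R2_permE s triple_lr1). Qed.

Lemma triple_s2E :
  [/\ forall w, w \notin [:: u; v] -> w != p -> s2 (oo w) = oo (s w),
      s2 (oo u) = C3 false, s2 (oo v) = C1 false & s2 (oo p) = C1 true] /\
  [/\ s2 (C1 true) = C3 true, s2 (C3 true) = C4 true & s2 (C4 true) = C2 true] /\
  [/\ s2 (C1 false) = C2 false, s2 (C2 false) = oo (s v),
      s2 (C3 false) = C4 false & s2 (C4 false) = oo (s u)].
Proof.
have [sw [sl s1l s2l] [sr s1r s2r]] := triple_s1E.
have [tw [tl t1l t2l] [tr t1r t2r]] := R2_permE s1 triple_lr2.
have uv : u != v by rewrite /=; apply/eqP => -[]; case: (sg x).
have up : u != p by have [] := triple_p; rewrite !inE negb_or eq_sym => /andP[+ _]; rewrite eq_sym.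
have o2 w : w != l2 -> w != r2 -> s2 (oldp bool w) = oldp bool (s1 w) := @tw w.
have oold w : w != u -> s2 (oo w) = oldp bool (s1 (oldp bool w)).
  by move=> wu; rewrite o2 // /l2 /r2 ?oldpE.
have onew y b : inl (inr y, b) != r2 -> s2 (oldp bool (inl (inr y, b))) = oldp bool (s1 (inl (inr y, b))).
  by move=> yr; rewrite o2 // /l2 new_oldp.
split; last split.
- split; [|exact: tl| |].
  + by move=> w; rewrite !inE negb_or => /andP[wu wv] wp; rewrite oold // sw.
  + by rewrite oold 1?eq_sym // sl.
  + by rewrite oold 1?eq_sym // sr.
- by split; rewrite ?tr ?t1r // t2r s1r.
- split; rewrite ?t1l //; [have := onew true false isT|have := onew false false isT|].
  + by rewrite s1l.
  + by rewrite s2l.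
  rewrite t2l sw //.
Qed.

Local Notation six := (R3_six M sg2 (inl (inr true)) (inr true) (inl (inl x))).

Lemma triple_not_six w : w \notin [:: u; v] -> oo w \notin six.
Proof.
move=> wn; have [wu wv] : w != u /\ w != v by move: wn; rewrite !inE negb_or => /andP.
apply/negP => /R3_sixP [] [].
- by move/eqP; rewrite -[R3_t1 _ _]/(oldp bool (inl (inr true, true))) !oldpE.
- by move/eqP; rewrite /R3_t3 oldpE.
- by move/eqP; rewrite -[R3_f1 _ _]/(oldp bool (inl (inr true, false))) !oldpE.
- by move/eqP; rewrite /R3_f3 oldpE.
- by move/eqP; rewrite -[R3_v _ _ _]/(oo v) !oldpE (negPf wv).
- by move/eqP; rewrite -[R3_u _ _ _]/(oo u) !oldpE (negPf wu).
Qed.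

Lemma triple_R3_hyps :
  [/\ s2 (R3_t1 M (inl (inr true))) = R3_t3 M (inr true),
      s2 (R3_v M sg2 (inl (inl x))) = R3_f1 M (inl (inr true)) &
      s2 (R3_u M sg2 (inl (inl x))) = R3_f3 M (inr true)] /\
  [/\ s2 (R3_t3 M (inr true)) \notin six,
      s2 (R3_f1 M (inl (inr true))) \notin six &
      s2 (R3_f3 M (inr true)) \notin six].
Proof.
have [[E1 E2 E3 E4] [[E5 E6 E7] [E8 E9 E10 E11]]] := triple_s2E.
split; split.
- exact: E5.
- exact: E3.
- exact: E2.
- by rewrite [s2 _]E6.
- by rewrite [s2 _]E8.
- by rewrite [s2 _]E10.
Qed.

Lemma triple_s3E :
  [/\ forall w, w \notin [:: u; v] -> w != p -> s w \notin [:: u; v] -> s3 (oo w) = oo (s w),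
      forall w, w \notin [:: u; v] -> w != p -> s w = u -> s3 (oo w) = C3 false &
      forall w, w \notin [:: u; v] -> w != p -> s w = v -> s3 (oo w) = C1 false] /\
  [/\ s3 (C3 true) = C1 true, s3 (C1 true) = C4 true & s3 (C4 true) = C2 true] /\
  [/\ s3 (C1 false) = oo v, s3 (oo v) = C2 false & s3 (C2 false) = oo (s v)] /\
  [/\ s3 (C3 false) = oo u, s3 (oo u) = C4 false & s3 (C4 false) = oo (s u)].
Proof.
have [[E1 E2 E3 E4] [[E5 E6 E7] [E8 E9 E10 E11]]] := triple_s2E.
have [[h1 h2 h3] [h4 h5 h6]] := triple_R3_hyps.
have [[q1 q2 q3 q4] [q5 q6 q7]] := R3_permE (isT : [&& inl (inr true) != inr true, inl (inr true) != inl (inl x) & inr true != inl (inl x) :> (X + bool) + bool]) h1 h2 h3 h4 h5 h6.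
have [[e1 e2 e3 e4] [e5 e6 e7]] := R3_swapE M sg2 (isT : [&& inl (inr true) != inr true, inl (inr true) != inl (inl x) & inr true != inl (inl x) :> (X + bool) + bool]).
split; split.
- by move=> w wx wp sx; rewrite [s3 _]q7 ?triple_not_six // E1 // e7 // triple_not_six.
- by move=> w wx wp sx; rewrite [s3 _]q7 ?triple_not_six // E1 // sx; apply: e6.
- by move=> w wx wp sx; rewrite [s3 _]q7 ?triple_not_six // E1 // sx; apply: e5.
- split; [exact: q1| |]; first by rewrite [s3 _]q2; apply: E6.
  by rewrite [s3 _]q7 // E7 e7.
have [uu vu] := (triple_succ (mem_head _ _ : u \in [:: u; v]), triple_succ (mem_last _ [:: v] : v \in [:: u; v])).
split; split.
- exact: q3.
- by rewrite [s3 _]q4; apply: E8.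
- by rewrite [s3 _]q7 // E9 e7 // triple_not_six.
- exact: q5.
- by rewrite [s3 _]q6; apply: E10.
- by rewrite [s3 _]q7 // E11 e7 // triple_not_six.
Qed.

Lemma triple_pl3 : planarb s3 sg2.
Proof.
have [[h1 h2 h3] [h4 h5 h6]] := triple_R3_hyps.
exact: R3_planar h1 h2 h3 h4 h5 h6 triple_pl2.
Qed.

Lemma triple_equiv : link_equiv (Diagram pl) (Diagram triple_pl3).
Proof.
have [[h1 h2 h3] [h4 h5 h6]] := triple_R3_hyps.
apply: le_trans (R2_equiv pl triple_pl1 triple_lr1) _.
apply: le_trans (R2_equiv triple_pl1 triple_pl2 triple_lr2) _.
exact: (R3_equiv _ _ _ h1 h2 h3).
Qed.

(* The crossing [x] takes part in the new tangle, so its half-edges are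
   represented by the ends of the tangle adjacent to them. *)
Definition triple_map (d : dart X M) : dart ((X + bool) + bool) M :=
  if d.1 \in [:: u; v]
  then if d.2 then (oo (s^-1%g d.1), false) else (oo (s d.1), true)
  else (oo d.1, d.2).
Local Notation h := triple_map.

Lemma triple_map_out w : w \notin [:: u; v] -> w != p ->
  con (trel s3) (h (w, false)) (h (s w, true)).
Proof.
have [[E1 E2 E3] _] := triple_s3E => wx wp; rewrite /h /= (negPf wx).
case: ifPn => sx; first by rewrite permK; apply: connect0.
by rewrite -E1 //; apply: con_trel_edge.
Qed.

(** This is the through strand of [e_2], from the left incoming end to the left outgoing end. It
    passes through the whole tangle except the incoming half-edges of [C3] and the outgoing ones of
    [C2], which form the two turning arcs of [e_2]. *)
Lemma triple_chain :
  con (trel s3) (h (v, true)) (h (u, false)) /\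
  [/\ forall b, con (trel s3) (C1 b, true) (h (u, false)),
      forall b, con (trel s3) (C1 b, false) (h (u, false)),
      forall b, con (trel s3) (C3 b, false) (h (u, false)) &
      forall b, con (trel s3) (C2 b, true) (h (u, false))] /\
  [/\ forall b, con (trel s3) (C4 b, true) (h (u, false)),
      forall b, con (trel s3) (C4 b, false) (h (u, false)) &
      forall b c, con (trel s3) (oo (inl (x, b)), c) (h (u, false))].
Proof.
have [[E1 E2 E3] [[F1 F2 F3] [[G1 G2 G3] [H1 H2 H3]]]] := triple_s3E.
have E w w' : s3 w = w' -> con (trel s3) (w, false) (w', true).
  by move=> <-; apply: con_trel_edge.
have E' w w' : s3 w = w' -> con (trel s3) (w', true) (w, false).
  by move=> sw; rewrite con_sym; apply: E.
have S b c : con (trel s3) (C1 b, c) (C1 (~~ b), c) by exact: (con_trel_smooth s3 (C1 b, c)).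
have S2 b c : con (trel s3) (C2 b, c) (C2 (~~ b), c) by exact: (con_trel_smooth s3 (C2 b, c)).
have S3 b c : con (trel s3) (C3 b, c) (C3 (~~ b), c) by exact: (con_trel_smooth s3 (C3 b, c)).
have S4 b c : con (trel s3) (C4 b, c) (C4 (~~ b), c) by exact: (con_trel_smooth s3 (C4 b, c)).
have Sx b c : con (trel s3) (oo (inl (x, b)), c) (oo (inl (x, ~~ b)), c).
  exact: (con_trel_smooth s3 (oo (inl (x, b)), c)).
set z := h (u, false).
have zE : z = (oo (s u), true) by rewrite /z /h /= in_cons eqxx.
have c4o b : con (trel s3) (C4 b, false) z.
  have H : con (trel s3) (C4 false, false) z by rewrite zE; apply: E.
  by case: b => //; apply: connect_trans (S4 true false) H.
have c2i b : con (trel s3) (C2 b, true) z.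
  have H : con (trel s3) (C2 true, true) z by apply: connect_trans (E' _ _ F3) (c4o _).
  by case: b => //; apply: connect_trans (S2 false true) H.
have xo b : con (trel s3) (oo (inl (x, b)), false) z.
  have H : con (trel s3) (oo v, false) z by apply: connect_trans (E _ _ G2) (c2i _).
  have [->//|/bool_neq->] := eqVneq b (~~ sg x).
  by apply: connect_trans (Sx _ _) _; rewrite negbK.
have c4i b : con (trel s3) (C4 b, true) z.
  have H : con (trel s3) (C4 false, true) z by apply: connect_trans (E' _ _ H2) (xo _).
  by case: b => //; apply: connect_trans (S4 true true) H.
have c1o b : con (trel s3) (C1 b, false) z.
  have H : con (trel s3) (C1 true, false) z by apply: connect_trans (E _ _ F2) (c4i _).
  by case: b => //; apply: connect_trans (S false false) H.
have xi b : con (trel s3) (oo (inl (x, b)), true) z.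
  have H : con (trel s3) (oo v, true) z by apply: connect_trans (E' _ _ G1) (c1o _).
  have [->//|/bool_neq->] := eqVneq b (~~ sg x).
  by apply: connect_trans (Sx _ _) _; rewrite negbK.
have c3o b : con (trel s3) (C3 b, false) z.
  have H : con (trel s3) (C3 false, false) z by apply: connect_trans (E _ _ H1) (xi _).
  by case: b => //; apply: connect_trans (S3 true false) H.
have c1i b : con (trel s3) (C1 b, true) z.
  have H : con (trel s3) (C1 true, true) z by apply: connect_trans (E' _ _ F1) (c3o _).
  by case: b => //; apply: connect_trans (S false true) H.
split; last by split=> //; split=> // b [].
have vx : v \in [:: u; v] by rewrite !in_cons eqxx orbT.
rewrite /h /= vx; apply: connect_trans (c1i false); apply: E; apply: E3.
- apply/negP => Vx; have := triple_succ Vx; by rewrite permKV vx.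
- apply/eqP => Vp; have [_ /negP[]] := triple_p; by rewrite -Vp permKV.
- by rewrite permKV.
Qed.

Lemma triple_ntau : ncomp (trel s3) < ncomp (trel s).
Proof.
have [ch [[c1i c1o c3o c2i] [c4i c4o cx]]] := triple_chain.
have [[E1 E2 E3] [[F1 F2 F3] [[G1 G2 G3] [H1 H2 H3]]]] := triple_s3E.
have [px spx] := triple_p.
pose Ra : {set dart X M} := [set d | d.1 \in [:: u; v]].
pose Rb : {set dart X M} := [set (p, false); (s p, true)].
have inRa d : (d \in Ra) = (d.1 \in [:: u; v]) by rewrite /Ra inE.
have uvP w : w \in [:: u; v] -> w = u \/ w = v by rewrite !inE => /orP[]/eqP->; [left|right].
have [smu smv] : (forall b, smooth (u, b) = (v, b)) /\ (forall b, smooth (v, b) = (u, b)).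
  by split=> b; rewrite /smooth /= ?negbK.
have smx d : d.1 \in [:: u; v] -> (smooth d).1 \in [:: u; v].
  case: d => w b /= /uvP[] ->; first by rewrite smu !in_cons eqxx orbT.
  by rewrite smv in_cons eqxx.
(* The tangle replaces the two smoothing arcs at [x] and the edge leaving [p]. These lie on three
   different circles, so each circle is cut once. *)
have hmap d e : trel s d e -> con (trel s3) (h d) (h e).
  apply: (trel_cut_map (Ra := Ra) (Rb := Rb)) => {d e}.
  - case=> [w b] [w' b']; rewrite !inRa /= => wx ww' wx'.
    have bb : b = b'.
      case: b b' ww' => [] [] // H; first by have := triple_in_out wx wx'; rewrite H.
      by have := triple_in_out wx' wx; rewrite con_sym H.
    rewrite -bb; case: (uvP _ wx) => ->; case: (uvP _ wx') => ->; rewrite ?smu ?smv;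
      by [left|right].
  - move=> d e; rewrite !inE => /orP[]/eqP-> _ /orP[]/eqP->; rewrite /edge /= ?permK;
      by [left|right].
  - case=> [w b] e; rewrite inRa /= => wx we; rewrite !inE negb_or; apply/andP; split.
      by apply: contraTneq we => ->; apply: triple_far.
    apply: contraTneq we => ->; apply/negP => H.
    have := triple_far b wx; rewrite (connect_trans H) // con_sym.
    exact: con_trel_edge.
  - case=> [w b]; rewrite inRa /= => wx; rewrite /h /= (negPf wx).
    have snx : (smooth (w, b)).1 \notin [:: u; v].
      by apply: contra wx => /smx; rewrite smoothK.
    rewrite (negPf snx) -[X in con _ _ X](_ : smooth (oo w, b) = _); last first.
      by case: w {wx snx} => [[]|].
    exact: con_trel_smooth.
  - case=> [w []] wb; rewrite /edge /=; last first.
      have wp : w != p by apply: contraNneq wb => ->; rewrite !inE eqxx.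
      have [wx|wx] := boolP (w \in [:: u; v]); last exact: triple_map_out.
      by rewrite /h /= wx (negPf (triple_succ wx)); apply: connect0.
    rewrite con_sym; have [wx|wx] := boolP (s^-1%g w \in [:: u; v]).
      have := triple_succ wx; rewrite permKV => wn.
      by rewrite /h /= wx (negPf wn) permKV; apply: connect0.
    rewrite -{2}(permKV s w); apply: triple_map_out => //.
    by apply: contraNneq wb => wp; rewrite !inE -wp permKV eqxx orbT.
(* The through strand joins the incoming to the outgoing circle of [x]. There is no closed loop in
   the tangle, so [A] is empty and this one merge gives strictness. *)
have nuv : ~~ con (trel s) (v, true) (u, false).
  by apply: triple_in_out; rewrite !in_cons eqxx ?orbT.
have := ncomp_lt_map (A := set0) hmap _ nuv ch; rewrite cards0 addn0; apply => y; left.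
have E w w' : s3 w = w' -> con (trel s3) (w, false) (w', true).
  by move=> <-; apply: con_trel_edge.
have vx : v \in [:: u; v] by rewrite !in_cons eqxx orbT.
have ux : u \in [:: u; v] by rewrite !in_cons eqxx.
have hu : con (trel s3) (C3 false, true) (h (u, true)).
  rewrite con_sym /h /= ux; apply: E; apply: E2; last by rewrite permKV.
    apply/negP => Vx; have := triple_succ Vx; by rewrite permKV ux.
  apply/eqP => Vp; have [_ /negP[]] := triple_p; by rewrite -Vp permKV.
have hv : con (trel s3) (C2 false, false) (h (v, false)).
  by rewrite /h /= vx; apply: E.
case: y => w b; case: (pt_extP w) => {w} [w|[] ov].
  case: (pt_extP w) => {w} [w|[] ov].
  - have [wx|wx] := boolP (w \in [:: u; v]); last first.
      by exists (w, b); rewrite /h /= (negPf wx); apply: connect0.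
    by exists (u, false); case: (uvP _ wx) => ->; apply: cx.
  - by exists (u, false); case: b; [apply: c1i|apply: c1o].
  - case: b; first by exists (u, false); apply: c2i.
    exists (v, false); case: ov; last exact: hv.
    exact: connect_trans (con_trel_smooth s3 (C2 true, false)) hv.
- case: b; last by exists (u, false); apply: c3o.
  exists (u, true); case: ov; last exact: hu.
  exact: connect_trans (con_trel_smooth s3 (C3 true, true)) hu.
- by exists (u, false); case: b; [apply: c4i|apply: c4o].
Qed.
End TripleMove.

(** * Bringing a third circle next to a crossing *)

Definition reducible (D : diagram) : Prop :=
  exists D', link_equiv D D' /\ ntau D' < ntau D.

Lemma reducible_step D D1 :
  link_equiv D D1 -> ntau D1 <= ntau D -> reducible D1 -> reducible D.
Proof.
move=> DD1 le [D2 [D12 lt]]; exists D2; split; first exact: le_trans DD1 D12.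
exact: leq_trans lt le.
Qed.

Section Route.
Variables (X M : finType) (s : {perm pt X M}) (sg : X -> bool) (x : X).
Local Notation u := (inl (x, sg x) : pt X M).
Local Notation v := (inl (x, ~~ sg x) : pt X M).

(** A step of a walk over the sphere: on around the current face, or across an edge to its other
    side. *)
Definition dart_step : rel (dart X M) :=
  fun d e => (e == face_step s sg d) || (e == edge s d).

(** The smoothing joins [u] to [v], so the two circles tested here are all those that touch [x]. *)
Definition off_crossing (d : dart X M) : bool :=
  ~~ con (trel s) (u, true) d && ~~ con (trel s) (u, false) d.

(* It lies on the face to the right of both strands of [x]. *)
Definition corner : dart X M := (v, false).

Lemma off_con d e : con (trel s) d e -> off_crossing d = off_crossing e.
Proof.
move=> de; rewrite /off_crossing !(same_connect_r _ de) //; exact: con_sym.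
Qed.

Lemma off_edge d : off_crossing (edge s d) = off_crossing d.
Proof. by apply: off_con; rewrite con_sym; apply: con1; rewrite /trel /rel_of2 /= eqxx orbT. Qed.

Lemma off_succ w : off_crossing (s w, true) = off_crossing (w, false).
Proof. exact: (off_edge (w, false)). Qed.

Lemma corner_on : off_crossing corner = false.
Proof.
rewrite /off_crossing; apply/negbTE; rewrite negb_and !negbK; apply/orP; right.
exact: (con_trel_smooth s (u, false)).
Qed.

(** The bound [n] is the induction measure: it survives changes of the diagram, unlike the walk
    itself. *)
Definition has_route (n : nat) : Prop :=
  ~~ con (trel s) (u, true) (u, false) /\
  exists q, [/\ size q <= n, path dart_step corner q & off_crossing (last corner q)].

(** Cutting the walk at its last crossing of an edge leaves a final piece inside one face. *)
Lemma step_path_split d0 q : path dart_step d0 q ->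
  fpath (face_step s sg) d0 q \/
  exists p1 p2, q = p1 ++ edge s (last d0 p1) :: p2 /\
    fpath (face_step s sg) (edge s (last d0 p1)) p2.
Proof.
elim: q d0 => [|a q IH] d0 /=; first by left.
case/andP => /orP[]/eqP aE /IH [fq|[p1 [p2 [-> fq]]]].
- by left; rewrite /= aE eqxx -aE.
- by right; exists (a :: p1), p2.
- by right; exists [::], q; rewrite -aE.
- by right; exists (a :: p1), p2.
Qed.

Lemma fpath_con d0 q : fpath (face_step s sg) d0 q ->
  con (next_rel (face_step s sg)) d0 (last d0 q).
Proof.
elim: q d0 => [|a q IH] d0 /=; first by move=> _; apply: connect0.
case/andP=> /eqP <- /IH; apply: connect_trans; exact: con_next.
Qed.
End Route.

Section Finger.
Variables (X M : finType) (s : {perm pt X M}) (sg : X -> bool) (pl : planarb s sg) (x : X).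
Local Notation u := (inl (x, sg x) : pt X M).
Local Notation off := (off_crossing s sg x).
Local Notation d0 := (corner M sg x).
Hypothesis nu : ~~ con (trel s) (u, true) (u, false).

(* The third circle meets the face on the other side of the edge of [e]: after
   pushing its strand across that edge, the new small circle meets the face of
   [e], so the route ends there. *)
Lemma finger (n : nat) (l r : pt X M) (z : bool) (p1 : seq (dart X M)) :
  let e := last d0 p1 in
  (forall (X' : finType) (s' : {perm pt X' M}) sg' (pl' : planarb s' sg') x',
     has_route s' sg' x' n -> reducible (Diagram pl')) ->
  size p1 < n -> path (dart_step s sg) d0 p1 -> uniq (d0 :: p1) -> ~~ has off (d0 :: p1) ->
  e = (if z then (s l, true) else (r, false)) -> edge s e \notin d0 :: p1 ->
  off (if z then r else l, false) ->
  con (next_rel (face_step s sg)) (l, false) (s r, true) -> reducible (Diagram pl).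
Proof.
move=> e IH sz pth un noff eE ne offw face.
set w := if z then r else l in offw; pose w' := if z then l else r.
have ew' : con (trel s) e (w', false).
  by rewrite eE /w'; case: (z); rewrite ?connect0 // con_sym con_trel_edge.
have offe : ~~ off e by apply: contra noff => oe; apply/hasP; exists e; rewrite ?mem_last.
have nww' : ~~ con (trel s) (w, false) (w', false).
  apply: contra offe => ww'; rewrite (off_con _ _ ew') -(off_con _ _ ww'); exact: offw.
have nlr : ~~ con (trel s) (l, false) (r, false).
  by move: nww'; rewrite /w /w'; case: (z); rewrite // con_sym.
have lr : l != r by apply: contraNneq nlr => ->; apply: connect0.
have pl2 : planarb (R2_perm s l r) (R2_sgn sg) by apply: R2_planar => //; left.
apply: reducible_step (R2_equiv pl pl2 lr) (R2_ntau lr nlr) _.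
apply: (IH _ _ _ _ (inl x)); split.
  case/andP: offw => o1 o2.
  exact: (@R2_trel_merge X M s l r lr z (u, true) (u, false)).
(* The walk before [e] keeps away from both subdivided edges: from that of [e] because the walk is
   simple and misses [edge s e], and from that of [w] because [w] lies on a third circle. The walk
   thus survives the move. *)
have far d : d \in belast d0 p1 ->
    if d.2 then d.1 \notin [:: s l; s r] else d.1 \notin [:: l; r].
  move=> db; have dp : d \in d0 :: p1 by apply: mem_belast.
  have nd : ~~ off d by apply: contra noff => od; apply/hasP; exists d.
  have de : d != e.
    move: un; rewrite lastI rcons_uniq => /andP[+ _].
    by apply: contraNneq => de; rewrite -/e -de.
  have dee : d != edge s e by apply: contraNneq ne => dee; rewrite -dee.
  have n1 : d != (w, false) by apply: contraNneq nd => ->.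
  have n2 : d != (s w, true) by apply: contraNneq nd => ->; rewrite off_succ.
  move: de dee n1 n2; rewrite eE /w; case: d {db dp nd} => a b.
  case: (z); case: b; rewrite /edge /= ?permK !inE !xpair_eqE /= ?andbT ?andbF;
    by move=> h1 h2 h3 h4; rewrite negb_or; apply/andP.
have mpath : path (dart_step (R2_perm s l r) (R2_sgn sg)) (oldd bool d0) (map (oldd bool) p1).
  have G pp dd : path (dart_step s sg) dd pp -> {subset belast dd pp <= belast d0 p1} ->
      path (dart_step (R2_perm s l r) (R2_sgn sg)) (oldd bool dd) (map (oldd bool) pp).
    elim: pp dd => //= a pp IHp dd /andP[st pth'] sub; apply/andP; split.
      have /far fd : dd \in belast d0 p1 by apply: sub; rewrite mem_head.
      by rewrite /dart_step R2_face_step // R2_edge //; case/orP: st => /eqP->; rewrite eqxx ?orbT.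
    by apply: IHp => // y yp; apply: sub; rewrite in_cons yp orbT.
  by apply: G.
pose tip := face_step (R2_perm s l r) (R2_sgn sg) (oldd bool e).
have tipin : R2_inner tip.
  have [tr tl] := R2_face_step_tip s sg lr.
  by rewrite /tip eE; case: (z).
(* The small circle contains no old half-edge, in particular none at [x], and can play the third
   circle. *)
have out d : ~~ con (trel (R2_perm s l r)) (oldd bool d) tip.
  by apply/negP => /(R2_trel_inner lr); rewrite tipin /R2_inner ext_dart_fun_oldd.
have -> : corner M (R2_sgn sg) (inl x) = oldd bool d0 by [].
exists (rcons (map (oldd bool) p1) tip); split.
- by rewrite size_rcons size_map.
- rewrite rcons_path mpath last_map -/e /dart_step eqxx //.
- rewrite last_rcons; apply/andP; split; [exact: (out (u, true))|exact: (out (u, false))].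
Qed.
End Finger.

Section KinkRoute.
Variables (X M : finType) (s : {perm pt X M}) (sg : X -> bool) (x : X).
Variables (p : pt X M) (b : bool).
Local Notation s1 := (R1_perm s p).
Local Notation sg1 := (R1_sgn sg b).
Local Notation off := (off_crossing s sg x).
Local Notation old := (oldd unit).
Hypothesis offp : off (p, false).

Lemma R1_off d : off_crossing s1 sg1 (inl x) (old d) = off d.
Proof. by rewrite /off_crossing -!(R1_trel s p). Qed.

Lemma R1_off_new ov d : off_crossing s1 sg1 (inl x) (inl (inr tt, ov), d).
Proof. by rewrite (off_con _ _ (R1_trel_new s p ov d)) R1_off. Qed.

Lemma R1_step d : ~~ off d -> edge s1 (old d) = old (edge s d) /\
  face_step s1 sg1 (old d) = old (face_step s sg d).
Proof.
move=> nd; have d1 : d != (p, false) by apply: contraNneq nd => ->.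
have d2 : d != (s p, true) by apply: contraNneq nd => ->; rewrite off_succ.
by rewrite R1_edge // R1_face_step.
Qed.

Lemma R1_path d0 q : path (dart_step s sg) d0 q -> ~~ has off (belast d0 q) ->
  path (dart_step s1 sg1) (old d0) (map old q).
Proof.
elim: q d0 => //= a q IH d0 /andP[st pth]; rewrite negb_or => /andP[nd nq].
rewrite IH // andbT; have [e1 e2] := R1_step nd.
by rewrite /dart_step e1 e2; case/orP: st => /eqP->; rewrite eqxx ?orbT.
Qed.

Lemma R1_fpath d0 q : fpath (face_step s sg) d0 q -> ~~ has off (belast d0 q) ->
  fpath (face_step s1 sg1) (old d0) (map old q).
Proof.
elim: q d0 => //= a q IH d0 /andP[/eqP <- pth]; rewrite negb_or => /andP[nd nq].
by rewrite IH // andbT; have [_ ->] := R1_step nd.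
Qed.

(** If the third circle runs past a face in the wrong direction for a parallel move, the loop of a
    kink offers an edge of the same circle that borders this face on its other side. *)
Lemma R1_kink_face f0 q dl : fpath (face_step s sg) f0 (rcons q dl) ->
  ~~ has off (f0 :: q) -> dl = (if b then (s p, true) else (p, false)) ->
  con (next_rel (face_step s1 sg1)) (old f0)
    (if b then (inl (inr tt, true), false) else (s1 (inl (inr tt, true)), true)).
Proof.
move=> fq nq dlE; apply: (@connect_trans _ _ (old dl)).
  have := fpath_con (R1_fpath fq _); rewrite last_map last_rcons; apply.
  by rewrite belast_rcons.
have := R1_face_step_loop s sg p b; rewrite dlE.
by case: (b) => <-; apply: con_next.
Qed.
End KinkRoute.

Lemma oldd_inj (X Y M : finType) : injective (@oldd X Y M).
Proof. by move=> [w b] [w' b'] [/oldp_inj-> ->]. Qed.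

(** Induction on the length of the walk. A walk inside the corner face permits the triple move.
    Otherwise a finger of the third circle is pushed across the last edge that the walk crosses,
    which gives a shorter walk. *)
Lemma has_route_reducible n (X M : finType) (s : {perm pt X M}) sg
    (pl : planarb s sg) x :
  has_route s sg x n -> reducible (Diagram pl).
Proof.
elim: n X M s sg pl x => [|n IH] X M s sg pl x [nu [q [sq pth offl]]].
  by move: sq offl; rewrite leqn0 size_eq0 => /eqP->; rewrite /= corner_on.
set d0 := corner M sg x in pth offl; pose off := off_crossing s sg x.
move: offl; case/shortenP: pth => q' pth un sub offl.
have {sub sq q} : size q' <= n.+1.
  by apply: leq_trans sq; apply: uniq_leq_size sub; case/andP: un.
case/lastP: q' pth un offl => [|q0 dl]; first by rewrite /= corner_on.
rewrite size_rcons ltnS last_rcons => pth un offl sq.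
(* If a third circle is met earlier, the walk can stop there. *)
have [/hasP[g gq gg]|nq] := boolP (has off q0).
  apply: (IH _ _ _ _ _ x); split=> //; case/path.splitP: gq pth sq => p1 p2.
  rewrite rcons_path cat_path size_cat => /andP[/andP[pth _] _] sq.
  exists (rcons p1 g); split; rewrite ?last_rcons //.
  exact: leq_trans (leq_addr _ _) sq.
have noff : ~~ has off (d0 :: q0) by rewrite /= negb_or {1}/off /d0 corner_on.
have offpw w : off (w, true) -> off (s^-1%g w, false) by rewrite /off -off_succ permKV.
case: (step_path_split pth) => [fq|[p1 [p2 [qE fq]]]].
  have fc : con (next_rel (face_step s sg)) d0 dl.
    by have := fpath_con fq; rewrite last_rcons.
  case: dl offl fq fc {pth un} => w [] offl fq fc.
    have ow := offpw _ offl; have /andP[o1 o2] := ow.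
    rewrite -(permKV s w) in fc.
    exists (Diagram (triple_pl3 pl o1 o2 fc)); split; first exact: triple_equiv.
    exact: triple_ntau.
  have pl1 := R1_planar w false pl.
  apply: reducible_step (R1_equiv pl pl1) (R1_ntau s w) _.
  have nu1 : ~~ con (trel (R1_perm s w)) (oldd unit (inl (x, sg x), true))
                                        (oldd unit (inl (x, sg x), false)).
    by rewrite R1_trel.
  have /andP[o1 o2] := @R1_off_new X M s sg x w false offl true false.
  have fc1 := @R1_kink_face X M s sg x w false offl _ _ _ fq noff erefl.
  exists (Diagram (triple_pl3 (x := inl x) pl1 o1 o2 fc1)); split.
    exact: triple_equiv.
  exact: triple_ntau.
set e := last d0 p1 in qE fq.
have offe : off (edge s e) = off e by apply: off_edge.
(* The walk cannot end right after crossing the edge of [e]: both halves of an edge lie on the same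
   circle. *)
case/lastP: p2 qE fq => [|p2 dl'] qE fq.
  move: qE; rewrite cats1 => /rcons_inj[qp dle].
  case/negP: noff; apply/hasP; exists e; first by rewrite qp mem_last.
  by rewrite -offe -dle.
move: qE; rewrite -rcons_cons -rcons_cat => /rcons_inj[qE dlE].
rewrite -{}dlE {dl'} in fq.
have sp : size p1 < n by apply: leq_trans sq; rewrite qE size_cat /= addnS ltnS leq_addr.
have pth1 : path (dart_step s sg) d0 p1.
  by move: pth; rewrite rcons_path qE cat_path => /andP[/andP[]].
have un0 : uniq (d0 :: p1) && (edge s e \notin d0 :: p1).
  move: un; rewrite qE -cats1 -catA -cat_cons cat_uniq => /and3P[-> nh _] /=.
  apply: contra nh => He; apply/hasP; exists (edge s e) => //.
  by rewrite mem_head.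
case/andP: un0 => un1 ne1.
have noff1 : ~~ has off (d0 :: p1).
  by apply: contra noff => /hasP[y yp oy]; apply/hasP; exists y; rewrite // qE -cat_cons mem_cat yp.
have noff2 : ~~ has off (edge s e :: p2).
  by apply: contra noff => /hasP[y yp oy]; apply/hasP; exists y; rewrite // qE in_cons mem_cat yp !orbT.
have fc : con (next_rel (face_step s sg)) (edge s e) dl.
  by have := fpath_con fq; rewrite last_rcons.
have noffe : ~~ off e by apply: contra noff1 => oe; apply/hasP; exists e; rewrite ?mem_last.
have noffne w b : off (w, b) -> e != (w, b) by move=> ow; apply: contraNneq noffe => ->.
have IHM (X' : finType) (s' : {perm pt X' M}) sg' (pl' : planarb s' sg') x' :
  has_route s' sg' x' n -> reducible (Diagram pl') by apply: IH.
(* For opposite directions around the face: a kink is first put into the third circle, and its loop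
   edge, leaving [inl (inr tt, true)], is pushed across. *)
have finger1 p b (offp : off (p, false)) (l r : pt (X + unit) M) (z : bool) :
  oldd unit e = (if z then (R1_perm s p l, true) else (r, false)) ->
  (if z then r else l) = inl (inr tt, true) ->
  con (next_rel (face_step (R1_perm s p) (R1_sgn sg b))) (l, false) (R1_perm s p r, true) ->
  reducible (Diagram pl).
  move=> eE wE fc1; have pl1 := R1_planar p b pl.
  apply: reducible_step (R1_equiv pl pl1) (R1_ntau s p) _.
  have map_off q1 : has (off_crossing (R1_perm s p) (R1_sgn sg b) (inl x)) (map (oldd unit) q1)
      = has off q1.
    by rewrite has_map; apply: eq_has => d; apply: R1_off.
  apply: (finger pl1 (x := inl x) _ IHM (p1 := map (oldd unit) p1) (l := l) (r := r) (z := z)).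
  - by have := nu; rewrite -(R1_trel s p).
  - by rewrite size_map.
  - apply: (R1_path b offp pth1); move: noff1.
    by rewrite lastI has_rcons negb_or => /andP[].
  - have := map_inj_uniq (@oldd_inj X unit M) (d0 :: p1); rewrite un1 => H; exact: H.
  - by have := map_off (d0 :: p1); rewrite (negPf noff1) => /negbT.
  - by rewrite -[corner _ _ _]/(oldd unit d0) last_map.
  - rewrite -[corner _ _ _]/(oldd unit d0) last_map -/e.
    have [-> _] := R1_step b offp noffe.
    by have := mem_map (@oldd_inj X unit M) (d0 :: p1) (edge s e) => H; rewrite -H in ne1.
  - by rewrite wE R1_off_new.
  - exact: fc1.
case E : e => [a []].
  rewrite {1}E /edge /= in fc.
  case: dl offl fq fc {pth un} => w [] offl fq fc.
    have ow := offpw _ offl.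
    apply: (finger pl nu IHM (l := s^-1%g a) (r := s^-1%g w) (z := true) sp pth1 un1 noff1).
    - by rewrite -/e E permKV.
    - exact: ne1.
    - exact: ow.
    - by rewrite permKV.
  have := @R1_kink_face X M s sg x w false offl _ _ _ fq noff2 erefl => fc1.
  have [s1w s1p s1t s1f] := R1_permE s w.
  apply: (finger1 w false offl (oldp unit (s^-1%g a)) (inl (inr tt, true)) true) => //.
  - rewrite s1w ?permKV ?E //; apply: contraNneq noffe => aw.
    by rewrite E -[a](permKV s) aw /off off_succ.
  - by move: fc1; rewrite {1}E /edge.
rewrite {1}E /edge /= in fc.
case: dl offl fq fc {pth un} => w [] offl fq fc; last first.
  apply: (finger pl nu IHM (l := w) (r := a) (z := false) sp pth1 un1 noff1).
  - by rewrite -/e E.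
  - exact: ne1.
  - exact: offl.
  - by rewrite con_sym.
have ow := offpw _ offl.
have := @R1_kink_face X M s sg x _ true ow _ _ _ fq noff2; rewrite permKV => /(_ erefl) fc1.
have [s1w s1p s1t s1f] := R1_permE s (s^-1%g w).
apply: (finger1 (s^-1%g w) true ow (inl (inr tt, true)) (oldp unit a) false) => //.
- by rewrite E.
- rewrite s1w; last by apply: contraNneq (noffne _ _ ow) => <-; rewrite E.
  by move: fc1; rewrite {1}E /edge con_sym.
Qed.

(** * Connected diagrams and the descent to two circles *)

Lemma ncomp_le1_con (T : finType) (r : rel T) a b : ncomp r <= 1 -> con r a b.
Proof.
rewrite ncompE => /card_le1_eqP H.
have R x : root (sym_rel r) x \in roots (sym_rel r) by apply: roots_root; apply: con_sym.
by rewrite -(root_connect (@con_sym _ r)); apply/eqP; apply: H.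
Qed.

(** The model does not record the relative position of different components of a diagram, so a
    Reidemeister II move may join any two of their edges. These lie on different circles, hence the
    number of circles does not grow. *)
Lemma exists_connected (X M : finType) (s : {perm pt X M}) sg (pl : planarb s sg) :
  exists (X' : finType) (s' : {perm pt X' M}) sg' (pl' : planarb s' sg'),
    [/\ link_equiv (Diagram pl) (Diagram pl'), ncomp (trel s') <= ncomp (trel s)
      & ncomp (crel s' sg') <= 1].
Proof.
have [n] := ubnP (ncomp (crel s sg)); elim: n X s sg pl => // n IH X s sg pl.
have [le1 _|gt1] := leqP (ncomp (crel s sg)) 1.
  by exists X, s, sg, pl; split; [apply: le_refl|apply: leqnn|].
rewrite ltnS => len.
have [|d _] := @exists_ncon _ (crel s sg) set0; first by rewrite cards0 ltnW.
have [|e nde] := @exists_ncon _ (crel s sg) [set d]; first by rewrite cards1.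
have {}nde : ~~ con (crel s sg) (e.1, false) (d.1, false).
  apply: contra (nde d (set11 _)) => ed; apply: (@connect_trans _ _ (e.1, false)).
    exact: con_vertex.
  by apply: (connect_trans ed); apply: con_vertex.
have lr : e.1 != d.1 by apply: contraNneq nde => ->; apply: connect0.
have pl2 : planarb (R2_perm s e.1 d.1) (R2_sgn sg) by apply: R2_planar => //; right.
have [|X' [s' [sg' [pl' [eq' le' c']]]]] := IH _ _ _ pl2.
  exact: leq_trans (R2_crel_join lr nde) len.
exists X', s', sg', pl'; split; last exact: c'.
  exact: le_trans (R2_equiv pl pl2 lr) eq'.
apply: (leq_trans le'); apply: R2_ntau; first exact: lr.
by apply: contra nde; apply: trel_crel.
Qed.

(** Injective maps on a finite set are inverted by iterating them, so steps in the forward direction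
    suffice. *)
Lemma con_crel_step (X M : finType) (s : {perm pt X M}) (sg : X -> bool) d e :
  con (crel s sg) d e -> connect (dart_step s sg) d e.
Proof.
have stE a : connect (dart_step s sg) a (edge s a).
  by apply: connect1; rewrite /dart_step eqxx orbT.
have stR a : connect (dart_step s sg) a (rot sg a).
  apply: connect_trans (stE a) _; apply: connect1.
  by rewrite /dart_step /face_step edgeK eqxx.
apply: connect_sub => {d e} a b /orP[] /orP[] /eqP->; [exact: stR|exact: stE| |].
  have : fconnect (@rot X M sg) (rot sg b) b.
    by rewrite fconnect_sym ?fconnect1 //; exact: (@rot_dart_inj X M sg).
  by apply: connect_sub => c c' /eqP <-; apply: stR.
by rewrite -{2}(edgeK s b); apply: stE.
Qed.

(** If at every crossing the incoming and the outgoing circle agreed, the circle would be the same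
    all over a component, and a connected diagram would have at most one. So some [x] touches two
    circles, and a third is left to walk to. *)
Lemma connected_reducible (X M : finType) (s : {perm pt X M}) sg (pl : planarb s sg) :
  ncomp (crel s sg) <= 1 -> 2 < ncomp (trel s) -> reducible (Diagram pl).
Proof.
move=> c1 t3.
have [/existsP[x nx]|nex] := boolP [exists x, ~~ con (trel s) (inl (x, sg x), true) (inl (x, sg x), false)].
  have [|z nz] := @exists_ncon _ (trel s) [set (inl (x, sg x), true); (inl (x, sg x), false)].
    by apply: leq_ltn_trans t3; rewrite cards2; case: (_ != _).
  have /connectP[q pth zE] := con_crel_step (ncomp_le1_con (corner M sg x) z c1).
  apply: (@has_route_reducible (size q) _ _ _ _ _ x); split=> //; exists q; split=> //.
  by rewrite -zE /off_crossing; apply/andP; split; rewrite con_sym; apply: nz; rewrite !inE eqxx ?orbT.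
have io x b c : con (trel s) (inl (x, sg x), b) (inl (x, sg x), c).
  move: nex; rewrite negb_exists => /forallP/(_ x); rewrite negbK => H.
  by case: b c => [] []; rewrite ?connect0 // con_sym.
have S := con_trel_smooth s.
have cross x ov b : con (trel s) (inl (x, ov), b) (inl (x, sg x), true).
  have [->|/bool_neq->] := eqVneq ov (sg x); first exact: io.
  by apply: connect_trans (S _) _; rewrite /smooth /= negbK.
have cv d e : crel s sg d e -> con (trel s) d e.
  case/orP => /eqP->; last by apply: con1; rewrite /trel /rel_of2 /= eqxx orbT.
  have := vertex_rot sg d; case: d => [[[x ov]|m] b].
    case: (rot _ _) => [[[y ov']|//] b'] [->].
    by apply: connect_trans (cross _ _ _) _; rewrite con_sym.
  by move=> _; apply: S (inr m, b).
have := @ncomp_le_map _ _ (crel s sg) (trel s) id set0 cv.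
rewrite cards0 addn0 => H.
have {}H : ncomp (trel s) <= ncomp (crel s sg).
  by apply: H => y; left; exists y; apply: connect0.
by have := leq_trans t3 (leq_trans H c1).
Qed.

Lemma exists_ntau_le2 D : exists2 D', link_equiv D D' & ntau D' <= 2.
Proof.
have [n] := ubnP (ntau D); elim: n D => // n IH [X M s sg pl] tn.
have [X' [s' [sg' [pl' [eq' le' c']]]]] := exists_connected pl.
have [le2|gt2] := leqP (ncomp (trel s')) 2; first by exists (Diagram pl').
have [D2 [eq2 lt2]] := connected_reducible pl' c' gt2.
have [|D3 eq3 le3] := IH D2.
  by apply: leq_trans lt2 _; apply: leq_trans le' _; rewrite -ltnS.
by exists D3 => //; apply: le_trans eq' (le_trans eq2 eq3).
Qed.

Theorem theorem1p2 (D0 : diagram) (n : nat) :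
  ncomponents D0 = n -> 0 < n ->
  (odd n -> min_tau_is D0 1) /\ (~~ odd n -> min_tau_is D0 2).
Proof.
move=> nD0 n0.
have par D : link_equiv D0 D -> odd (ntau D) = odd n /\ 0 < ntau D.
  move=> /ncomponents_equiv; rewrite nD0 => nD; split.
    by rewrite nD; apply: ntau_parity (diagram_planar D).
  have E : ncomponents D = #|roots (sym_rel (next_rel (succ D)))| := ncompE _.
  (* A link component provides a point, hence a half-edge and a circle. With positivity, an even
     number of circles is at least 2. *)
  by move: n0; rewrite nD E => /card_gt0P[p _]; apply: ncomp_gt0 (p, true).
have [D1 eq1 le2] := exists_ntau_le2 D0; have [od1 gt1] := par _ eq1.
split=> [on|en]; split.
- exists D1; split=> //; move: le2 gt1 od1; rewrite on.
  by case: (ntau D1) => [|[|[|]]].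
- by move=> D /par[].
- exists D1; split=> //; move: le2 gt1 od1; rewrite (negPf en).
  by case: (ntau D1) => [|[|[|]]].
- by move=> D /par[]; rewrite (negPf en); case: (ntau D) => [|[]].
Qed.
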